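(* Let $d_1=d_1(n)$ and $d_2=d_2(n)$ be integer sequences with values in $\{1,\dots,n-1\}$, and consider the generalized inversion and descent statistics on the symmetric groups $S_n$. Let $\hat X_{\mathrm{inv}}^{(d_1)}$ be the Hájek projection of $X_{\mathrm{inv}}^{(d_1)}$, and let $$\rho=\lim_{n\to\infty}\mathrm{Corr}\bigl(\hat X_{\mathrm{inv}}^{(d_1)},X_{\mathrm{des}}^{(d_2)}\bigr).$$ Then, in each of the following cases, the limit $\rho$ exists and has the stated value. First, assume $d_1=o(n)$ and $\sqrt n=o(d_1)$. (a) If either $n-d_2=o(d_1)$ or $d_1=o(n-d_2)$, then $\rho=0$. (b) If $n-d_2=c\,d_1(1+o(1))$ for some constant $c\ge 1$, then $\rho=1/\sqrt{2c}$. (c) If $n-d_2=c\,d_1(1+o(1))$ for some constant $c\in(0,1)$, then $\rho=\sqrt{2c}\,(1-c/2)$. Now assume instead $d_1/n\to c_1$ and $d_2/n\to c_2$ with $0<c_1\le 1$ and $0\le c_2\le 1$. Put $$p(c_1)=-\tfrac{c_1^3}{2}+c_1^2-\tfrac{c_1}{2}+\tfrac1{12},\qquad f(c_1,c_2)=\sqrt{1-c_2}\,(2c_1+c_2-1),$$ $$g(c_1,c_2)=\frac{2c_1c_2-c_2^2}{\sqrt{1+c_2}},\qquad h(c_1,c_2)=\frac{2c_2(1-c_2)-(1-c_1)^2}{\sqrt{p(c_1)}}.$$ Then: (d) If $c_1\le c_2\le 1/2$, then $\rho=\frac{\sqrt6}{2}\sqrt{\frac{c_1}{1+c_2}}$.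 (e) If $c_1\le 1/2$ and $c_2>1/2$, then $\rho=\frac{\sqrt{c_1}}{\sqrt{2(1-c_2)}}$ if $c_2\le 1-c_1$, and $\rho=\frac{f(c_1,c_2)}{\sqrt2\,c_1^{3/2}}$ if $c_2>1-c_1$. (f) If $1/2<c_1\le c_2$, then $\rho=\frac{\sqrt3}{6}\cdot\frac{f(c_1,c_2)}{\sqrt{p(c_1)}}$. (g) If $1/2\ge c_1>c_2>0$, then $\rho=\frac{\sqrt6\,g(c_1,c_2)}{2c_1^{3/2}}$. (h) If $c_1>1/2$ and $c_2\le 1-c_1$, then $\rho=\frac{g(c_1,c_2)}{2\sqrt{p(c_1)}}$. (i) If $c_1>c_2>1-c_1$, then $\rho=\frac{h(c_1,c_2)}{2\sqrt{1+c_2}}$ if $c_2\le 1/2$, and $\rho=\frac{\sqrt3}{6}\cdot\frac{h(c_1,c_2)}{\sqrt{1-c_2}}$ if $c_2>1/2$. In particular, if $c_2=0$ then always $\rho=0$; and if $c_2=1$ and $c_1>0$, then $\rho=0$ as well.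
   Context: Let $Z_1,\dots,Z_n$ be i.i.d. uniform on $(0,1)$. For $d\in\{1,\dots,n-1\}$, on the symmetric group $S_n$ define $$X_{\mathrm{inv}}^{(d)}=\sum_{1\le i<j\le n,\ j-i\le d}\mathbf 1\{Z_i>Z_j\},\qquad X_{\mathrm{des}}^{(d)}=\sum_{i=1}^{n-d}\mathbf 1\{Z_i>Z_{i+d}\}.$$ The Hájek projection of a random variable $X$ with respect to the independent variables $Z_1,\dots,Z_n$ is $\hat X=\sum_{k=1}^n\mathbb E(X\mid Z_k)-(n-1)\mathbb E(X)$. Both statistics are built from the same $Z_1,\dots,Z_n$. $\mathrm{Corr}(X,Y)=\mathrm{Cov}(X,Y)/\sqrt{\mathrm{Var}(X)\mathrm{Var}(Y)}$. *)

(* Defs.v *)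
From HB Require Import structures.
From mathcomp Require Import all_boot all_order all_algebra.
From mathcomp Require Import all_classical all_reals all_analysis.

Set Implicit Arguments.
Unset Strict Implicit.
Unset Printing Implicit Defensive.

Import Order.TTheory GRing.Theory Num.Theory.
Import numFieldNormedType.Exports.

Local Open Scope classical_set_scope.
Local Open Scope ring_scope.

Section Probability.
Context {d : measure_display} {T : measurableType d} {R : realType}.
Variable P : probability T R.

(* Mutual independence of a finite family: the product rule is required for
   every subfamily [J]. *)
Definition mutually_independent (n : nat) (Z : 'I_n -> {RV P >-> R}) : Prop :=
  forall (J : {set 'I_n}) (B : 'I_n -> set R),
    (forall i, measurable (B i)) ->
    P (\bigcap_(i in [set` J]) (Z i @^-1` B i)) =
    (\prod_(i in J) P (Z i @^-1` B i))%E.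

Definition iid_uniform01 (n : nat) (Z : 'I_n -> {RV P >-> R}) : Prop :=
  mutually_independent Z /\
  forall i (B : set R), measurable B ->
    distribution P (Z i) B = uniform_prob (@ltr01 R) B.

(* [Y] is a version of E(X | W): it is integrable, measurable with respect to
   the sigma-algebra generated by [W], and has the same integral as [X] on
   every event of that sigma-algebra. *)
Definition is_cond_expectation (X : T -> R) (W : {RV P >-> R}) (Y : T -> R) :
    Prop :=
  let sigmaW := preimage_set_system setT W measurable in
  [/\ P.-integrable setT (EFin \o Y),
      forall B : set R, measurable B -> sigmaW (Y @^-1` B) &
      forall A : set T, sigmaW A ->
        (\int[P]_(w in A) (Y w)%:E = \int[P]_(w in A) (X w)%:E)%E].

(* Conditional expectations are determined only almost surely, so the Hajek
   projection is a relation: [Xhat] is a Hajek projection of [X] for any choice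
   of versions of the E(X | Z k). *)
Definition is_Hajek_projection (n : nat) (Z : 'I_n -> {RV P >-> R})
    (X Xhat : T -> R) : Prop :=
  exists Y : 'I_n -> T -> R,
    (forall k, is_cond_expectation X (Z k) (Y k)) /\
    (forall w, Xhat w = \sum_(k < n) Y k w - (n%:R - 1) * fine 'E_P[X]%E).

Definition correlation (X Y : T -> R) : R :=
  fine (covariance P X Y) / Num.sqrt (fine (variance P X) * fine (variance P Y)).

(* Indices are 0-based; only the differences of indices matter. *)
Definition X_inv (n d1 : nat) (Z : 'I_n -> {RV P >-> R}) (w : T) : R :=
  \sum_(i < n) \sum_(j < n | (i < j)%N && (j - i <= d1)%N)
    (Z j w < Z i w)%R%:R.

Definition X_des (n d2 : nat) (Z : 'I_n -> {RV P >-> R}) (w : T) : R :=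
  \sum_(i < n) \sum_(j < n | j == (i + d2)%N :> nat)
    (Z j w < Z i w)%R%:R.

End Probability.

Section Formulas.
Context {R : realType}.
Implicit Types c : R.

Definition p_corr c1 : R := - (c1 ^+ 3 / 2) + c1 ^+ 2 - c1 / 2 + 12^-1.

Definition f_corr c1 c2 : R := Num.sqrt (1 - c2) * (2 * c1 + c2 - 1).

Definition g_corr c1 c2 : R := (2 * c1 * c2 - c2 ^+ 2) / Num.sqrt (1 + c2).

Definition h_corr c1 c2 : R :=
  (2 * c2 * (1 - c2) - (1 - c1) ^+ 2) / Num.sqrt (p_corr c1).

End Formulas.

(* Main.v *)
Require Import Defs.
From HB Require Import structures.
From mathcomp Require Import all_boot all_order all_algebra.
From mathcomp Require Import all_classical all_reals all_analysis.
From mathcomp Require Import measurable_realfun ring lra zify.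

(* Conditioning on one variable linearises the inversion statistic: up to null
   sets and a constant, its Hajek projection is [sum_k a_k Z_k], where [a_k] is
   the number of windowed pairs having [k] as left index minus the number having
   [k] as right index. As [Cov(Z_k, 1{Z_i > Z_j}) = ([k = i] - [k = j]) / 12] and
   two descent indicators are correlated (with covariance [-1/12]) only when they
   form a chain [i, i + d2, i + 2 d2], the covariance and both variances are
   explicit polynomials in [d1], [d2], [n] and truncated differences of these.
   The limits follow after rescaling the indices by [n] (linear regime) or by
   [d1] (sublinear regime). *)

Import Order.TTheory GRing.Theory Num.Theory.
Import numFieldNormedType.Exports.

Local Open Scope classical_set_scope.
Local Open Scope ring_scope.

Set Implicit Arguments.
Unset Strict Implicit.
Unset Printing Implicit Defensive.

(** * Independence of one sample variable from the sigma-algebra generated by the others *)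

Section Independence.
Context {d : measure_display} {T : measurableType d} {R : realType}.
Variables (P : probability T R) (n : nat) (Z : 'I_n -> {RV P >-> R}).

(** All moments come from one device: a single variable is integrated against the uniform law while
    the sample point, seen only through the sigma-algebra of the other variables, stays frozen.
    Repeating it turns every expectation into a moment of one uniform variable; the constant 1/12 is
    its variance. In a scale of inverse [u], the covariance has weight [u^2] and the two variances
    have weights [u^3] and [u], so the correlation is scale invariant. Its limit can be read off
    termwise only where both rescaled variances have positive finite limits. This breaks down when
    [n - d2] is negligible or dominant against the scale, because the variance of the descents is of
    exact order [n - d2]. There the squared correlation is bounded instead, by one of two covariance
    estimates, each suited to one extreme. The case distinction of the theorem only records which
    side of each truncation is active: [min(d1, n - d2)], [min(d1, d2)], [max(0, 2 d1 - n)] and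
    [max(0, n - 2 d2)]. *)

Definition other_cylinders (l : 'I_n) : set (set T) :=
  [set \bigcap_(i in [set` [set~ l]%SET]) (Z i @^-1` B i) |
    B in [set B : 'I_n -> set R | forall i, measurable (B i)]].

Notation sigma_others l := (g_sigma_algebraType (other_cylinders l)).

Lemma measurable_cylinder (J : {set 'I_n}) (B : 'I_n -> set R) :
  (forall i, measurable (B i)) ->
  measurable (\bigcap_(i in [set` J]) (Z i @^-1` B i)).
Proof.
move=> mB; apply: fin_bigcap_measurable => // i _.
by rewrite -[X in measurable X]setTI; exact: measurable_funPT.
Qed.

Lemma other_cylinders_measurable l : other_cylinders l `<=` measurable.
Proof. by move=> _ [B mB <-]; exact: measurable_cylinder. Qed.

Lemma sigma_others_measurable l (A : set T) :
  <<s other_cylinders l >> A -> measurable A.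
Proof.
exact: (smallest_sub (@sigma_algebra_measurable _ T)
  (@other_cylinders_measurable l)).
Qed.

Lemma measurable_sigma_others l i : i != l ->
  measurable_fun [set: sigma_others l] (Z i : sigma_others l -> R).
Proof.
move=> il _ B mB; rewrite setTI; apply: sub_sigma_algebra.
exists (fun j => if j == i then B else setT).
  by move=> j; case: ifP.
apply/seteqP; split=> w /=.
  by move=> /(_ i); rewrite /= !inE il eqxx; apply.
by move=> Bw j _; case: eqP => [->|].
Qed.

Hypothesis HZ : mutually_independent Z.

(** As functions of [A], both sides are finite measures, a restriction and a scaling of [P]. They
    agree on the cylinders, which are stable under intersection and contain the whole space, hence
    on the generated sigma-algebra. *)
Lemma indep_sigma_others l (A : set T) (B : set R) :
  <<s other_cylinders l >> A -> measurable B ->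
  (P (A `&` Z l @^-1` B) = P A * P (Z l @^-1` B))%E.
Proof.
move=> sA mB.
have mZB : measurable (Z l @^-1` B).
  by rewrite -[X in measurable X]setTI; exact: measurable_funPT.
have finP : P (Z l @^-1` B) = (fine (P (Z l @^-1` B)))%:E.
  by rewrite fineK// fin_num_measure.
have r0 : 0 <= fine (P (Z l @^-1` B)) by rewrite fine_ge0.
pose r := NngNum r0.
have gT : other_cylinders l setT.
  exists (fun=> setT) => //; apply/seteqP; split=> //.
rewrite -[LHS]/(mrestr P mZB A).
rewrite muleC finP -[RHS]/(mscale r P A).
apply: (@g_sigma_algebra_measure_unique _ _ _ (other_cylinders l)
  (@other_cylinders_measurable l) (fun=> setT)) => //.
- by rewrite bigcup_const.
- move=> _ _ [B1 mB1 <-] [B2 mB2 <-].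
  exists (fun i => B1 i `&` B2 i); first by move=> i; exact: measurableI.
  by rewrite -bigcapI.
- move=> _ [C mC <-]; 
  change (P ((\bigcap_(i in [set` [set~ l]%SET]) (Z i @^-1` C i)) `&` Z l @^-1` B)
    = ((fine (P (Z l @^-1` B)))%:E *
       P (\bigcap_(i in [set` [set~ l]%SET]) (Z i @^-1` C i)))%E).
  (* Inserting [B] at coordinate [l] yields a cylinder over all indices, so the product rule applies
     on both sides and the products differ by the factor at [l]. *)
  pose C' i := if i == l then B else C i.
  have mC' i : measurable (C' i) by rewrite /C'; case: ifP.
  have -> : \bigcap_(i in [set` [set~ l]%SET]) (Z i @^-1` C i) `&` Z l @^-1` B =
      \bigcap_(i in [set` [set: 'I_n]%SET]) (Z i @^-1` C' i).
    apply/seteqP; split=> w /=.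
      by move=> [Cw Bw] i _; rewrite /C' /=; case: eqP => [->//|/eqP il];
        apply: Cw => /=; rewrite !inE.
    move=> Cw; split.
      move=> i /=; rewrite !inE => il.
      by have := Cw i; rewrite /C' (negbTE il); apply; rewrite /= !inE.
    by have := Cw l; rewrite /C' eqxx; apply; rewrite /= !inE.
  rewrite HZ// HZ// (bigD1 l) ?inE//= /C' eqxx -finP; congr (_ * _)%E.
  apply: eq_big => i; first by rewrite !inE.
  by move=> /andP[_ /negbTE ->].
- by move=> _; exact: fin_num_fun_lty.
Qed.

(** The identity map into the coarser measurable space [sigma_others l] plays the role of the vector
    of the other variables. Its joint law with [Z l] is a product measure, so Tonelli applies and
    [h] may depend on the sample point itself. *)
Lemma integrate_out l (h : T -> R -> R) :
  measurable_fun [set: (sigma_others l * R)%type]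
    (fun x : sigma_others l * R => h x.1 x.2) ->
  (forall w v, 0 <= h w v) ->
  (\int[P]_w (h w (Z l w))%:E =
   \int[P]_w \int[distribution P (Z l)]_v (h w v)%:E)%E.
Proof.
move=> mh h0.
have mid : measurable_fun [set: T] (idfun : T -> sigma_others l).
  by move=> _ B sB; rewrite setTI; apply: (@sigma_others_measurable l).
pose I : {mfun T >-> sigma_others l} := mfun_Sub (mem_set mid).
have mpair : measurable_fun [set: T]
    (fun w => (w, Z l w) : (sigma_others l * R)%type).
  by apply: measurable_fun_pair.
pose J : {mfun T >-> (sigma_others l * R)%type} := mfun_Sub (mem_set mpair).
have /measurable_EFinP mhE := mh.
have h0E (x : sigma_others l * R) : (0 <= (h x.1 x.2)%:E)%E by rewrite lee_fin.
transitivity (\int[distribution P J]_x (h x.1 x.2)%:E)%E.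
  by rewrite ge0_integral_distribution.
transitivity (\int[(distribution P I \x distribution P (Z l))%E]_x
   (h x.1 x.2)%:E)%E.
  apply: eq_measure_integral => A mA _; apply/esym.
  apply: product_measure_unique => // B C mB mC.
  by apply: indep_sigma_others.
rewrite fubini_tonelli1//.
rewrite ge0_integral_distribution//.
  exact: measurable_fun_fubini_tonelli_F.
by move=> w; apply: integral_ge0.
Qed.

End Independence.

(** * Distribution function and moments of the uniform law *)

Section Uniform.
Context {R : realType}.
Implicit Types u v : R.

Let mu := uniform_prob (@ltr01 R).

(** The distribution function of the uniform law on all of the real line. A uniform [Z i] lies in
    the unit interval only almost surely; clipping makes the formulas below hold at every sample
    point and gives bounded variables. *)
Definition clip01 (v : R) : R := Num.max 0 (Num.min v 1).

Lemma clip01_id v : 0 <= v <= 1 -> clip01 v = v.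
Proof. by move=> /andP[v0 v1]; rewrite /clip01 min_l// max_r. Qed.

Lemma clip01_ge0 v : 0 <= clip01 v.
Proof. by rewrite /clip01 le_max lexx. Qed.

Lemma clip01_le1 v : clip01 v <= 1.
Proof. by rewrite /clip01 ge_max ler01 ge_min lexx orbT. Qed.

Lemma measurable_clip01 : measurable_fun [set: R] clip01.
Proof. by apply: measurable_maxr => //; apply: measurable_minr. Qed.

Lemma measurable_ltr_natr d (T : measurableType d) (f g : T -> R) :
  measurable_fun setT f -> measurable_fun setT g ->
  measurable_fun setT (fun x => (f x < g x)%R%:R : R).
Proof.
move=> mf mg; rewrite (_ : (fun _ => _) = fun x => if f x < g x then 1 else 0).
  by apply: measurable_fun_ifT => //; exact: measurable_fun_ltr.
by apply/funext => x; case: ifP.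
Qed.

Lemma integral_uniform01 (f : R -> R) :
  measurable_fun setT f -> (forall v, 0 <= f v) ->
  (\int[mu]_v (f v)%:E = \int[lebesgue_measure]_(v in `[0%R, 1%R]) (f v)%:E)%E.
Proof.
move=> mf f0; rewrite integral_uniform.
- by rewrite subr0 invr1 mul1e.
- exact/measurable_EFinP.
- by move=> x; rewrite lee_fin.
Qed.

Lemma uniform01_lt u : (\int[mu]_v ((v < u)%R%:R)%:E = (clip01 u)%:E)%E.
Proof.
rewrite integral_uniform01//; last exact: measurable_ltr_natr.
rewrite (_ : (fun v => ((v < u)%R%:R)%:E) =
    fun v => (\1_`]-oo, u[%classic v : R)%:E); last first.
  by apply/funext => v; rewrite indicE mem_setE in_itv/=.
rewrite integral_indic//= setIC.
have [u0|u0] := leP u 0.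
  rewrite (_ : _ `&` _ = set0) ?measure0 /clip01.
    by rewrite max_l// ge_min u0.
  by apply/seteqP; split=> v //=; rewrite !in_itv/= => -[/andP[]]; lra.
have [u1|u1] := leP u 1.
  rewrite (_ : _ `&` _ = `[0, u[%classic).
    by rewrite lebesgue_measure_itv/= lte_fin u0 -EFinB subr0 clip01_id// u1 ltW.
  apply/seteqP; split=> v /=; rewrite !in_itv/=; last first.
    by move=> /andP[v0 vu]; rewrite v0 vu (le_trans (ltW vu)).
  by move=> -[/andP[-> _] ->].
rewrite (_ : _ `&` _ = `[0, 1]%classic).
  rewrite lebesgue_measure_itv/= lte_fin ltr01 -EFinB subr0 /clip01.
  by rewrite min_r ?(ltW u1)// max_r.
apply/seteqP; split=> v /=; rewrite !in_itv/=; first by case.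
by move=> /[dup] /andP[_ v1] ->; rewrite (le_lt_trans v1).
Qed.

Lemma uniform01_gt u : (\int[mu]_v ((u < v)%R%:R)%:E = (1 - clip01 u)%:E)%E.
Proof.
rewrite integral_uniform01//; last exact: measurable_ltr_natr.
rewrite (_ : (fun v => ((u < v)%R%:R)%:E) =
    fun v => (\1_`]u, +oo[%classic v : R)%:E); last first.
  by apply/funext => v; rewrite indicE mem_setE in_itv/= andbT.
rewrite integral_indic//= setIC.
have [u0|u0] := ltP u 0.
  rewrite (_ : _ `&` _ = `[0, 1]%classic).
    rewrite lebesgue_measure_itv/= lte_fin ltr01 -EFinB /clip01.
    by rewrite max_l// ge_min ltW.
  apply/seteqP; split=> v /=; rewrite !in_itv/= ?andbT; first by case.
  by move=> /[dup] /andP[v0 _] ->; rewrite (lt_le_trans u0).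
have [u1|u1] := ltP u 1.
  rewrite (_ : _ `&` _ = `]u, 1]%classic).
    by rewrite lebesgue_measure_itv/= lte_fin u1 -EFinB clip01_id// u0 ltW.
  apply/seteqP; split=> v /=; rewrite !in_itv/= ?andbT; last first.
    by move=> /andP[uv v1]; rewrite v1 uv (le_trans u0 (ltW uv)).
  by move=> -[/andP[_ ->] ->].
rewrite (_ : _ `&` _ = set0) ?measure0 /clip01.
  by rewrite min_r// max_r// subrr.
by apply/seteqP; split=> v //=; rewrite !in_itv/= => -[/andP[]]; lra.
Qed.

(** The integral of [v^k] over the unit interval is the beta value [B(k+1, 1) = k! / (k+1)!]. *)
Lemma uniform01_moment k :
  (\int[mu]_v (clip01 v ^+ k)%:E = (k.+1%:R^-1)%:E)%E.
Proof.
rewrite integral_uniform01; last 2 first.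
- exact: measurable_funX measurable_clip01.
- by move=> v; rewrite exprn_ge0// clip01_ge0.
transitivity ((\int[@lebesgue_measure R]_(v in `[0, 1]) XMonemX k 0 v)%R%:E).
  rewrite fineK; last exact: integrable_fin_num (integrable_XMonemX _ _).
  apply: eq_integral => v; rewrite mem_setE in_itv/= => v01.
  by rewrite XMonemXn0 clip01_id.
rewrite Rintegral_mkcond -/(beta_fun k.+1 1) beta_fun_fact addn0 fact0 muln1.
by rewrite factS natrM invfM mulrA mulrAC divff ?mul1r// pnatr_eq0 -lt0n fact_gt0.
Qed.

End Uniform.

(** * Expectation on bounded random variables, a class closed under sums and products *)

Section BoundedRV.
Context {d : measure_display} {T : measurableType d} {R : realType}.
Variable P : probability T R.
Implicit Types f g : T -> R.

Definition bounded_rv f : Prop :=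
  measurable_fun setT f /\ exists M, forall w, `|f w| <= M.

Lemma bounded_rv_cst c : bounded_rv (fun=> c).
Proof. by split; [exact: measurable_cst | exists `|c|]. Qed.

Lemma bounded_rvD f g : bounded_rv f -> bounded_rv g ->
  bounded_rv (fun w => f w + g w).
Proof.
move=> [mf [M fM]] [mg [N gN]]; split; first exact: measurable_funD.
by exists (M + N) => w; rewrite (le_trans (ler_normD _ _))// lerD.
Qed.

Lemma bounded_rvM f g : bounded_rv f -> bounded_rv g ->
  bounded_rv (fun w => f w * g w).
Proof.
move=> [mf [M fM]] [mg [N gN]]; split; first exact: measurable_funM.
by exists (M * N) => w; rewrite normrM ler_pM.
Qed.

Lemma bounded_rvZ c f : bounded_rv f -> bounded_rv (fun w => c * f w).
Proof. by move=> bf; apply: bounded_rvM => //; exact: bounded_rv_cst. Qed.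

Lemma bounded_rvB f g : bounded_rv f -> bounded_rv g ->
  bounded_rv (fun w => f w - g w).
Proof.
move=> bf bg; apply: bounded_rvD => //.
under eq_fun do rewrite -mulN1r.
exact: bounded_rvZ.
Qed.

Lemma bounded_rv_sum (I : Type) (s : seq I) (Q : pred I) (F : I -> T -> R) :
  (forall i, Q i -> bounded_rv (F i)) ->
  bounded_rv (fun w => \sum_(i <- s | Q i) F i w).
Proof.
move=> bF; elim: s => [|i s IH].
  by under eq_fun do rewrite big_nil; exact: bounded_rv_cst.
under eq_fun do rewrite big_cons.
case Qi: (Q i) => //.
by apply: bounded_rvD => //; exact: bF.
Qed.

Lemma bounded_rv_integrable f : bounded_rv f -> P.-integrable setT (EFin \o f).
Proof.
move=> [mf [M fM]]; apply: measurable_bounded_integrable => //.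
  by rewrite fin_num_fun_lty.
exists M; split; first exact: num_real.
by move=> x Mx w _; rewrite /= (le_trans (fM w))// ltW.
Qed.

Local Notation E f := (\int[P]_w f w).

Lemma mean_cst c : E (fun=> c) = c.
Proof.
by rewrite Rintegral_cst//= probability_setT mulr1.
Qed.

Lemma meanD f g : bounded_rv f -> bounded_rv g ->
  E (fun w => f w + g w) = E f + E g.
Proof. by move=> bf bg; rewrite RintegralD//; exact: bounded_rv_integrable. Qed.

Lemma meanB f g : bounded_rv f -> bounded_rv g ->
  E (fun w => f w - g w) = E f - E g.
Proof. by move=> bf bg; rewrite RintegralB//; exact: bounded_rv_integrable. Qed.

Lemma meanZ c f : bounded_rv f -> E (fun w => c * f w) = c * E f.
Proof. by move=> bf; rewrite RintegralZl//; exact: bounded_rv_integrable. Qed.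

Lemma mean_sum (I : Type) (s : seq I) (Q : pred I) (F : I -> T -> R) :
  (forall i, Q i -> bounded_rv (F i)) ->
  E (fun w => \sum_(i <- s | Q i) F i w) = \sum_(i <- s | Q i) E (F i).
Proof.
move=> bF; elim: s => [|i s IH].
  rewrite big_nil; under eq_Rintegral do rewrite big_nil.
  exact: mean_cst.
rewrite big_cons; under eq_Rintegral do rewrite big_cons.
case Qi: (Q i) => //; rewrite meanD ?IH//; first exact: bF.
exact: bounded_rv_sum.
Qed.

Lemma covariance_mean f g : 
  fine (covariance P f g) = E (fun w => (f w - E f) * (g w - E g)).
Proof. by rewrite unlock /= unlock. Qed.

End BoundedRV.

(** * Moments of the uniform sample and of its comparison indicators *)

Section UniformSample.
Context {d : measure_display} {T : measurableType d} {R : realType}.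
Variables (P : probability T R) (n : nat) (Z : 'I_n -> {RV P >-> R}).
Hypothesis HZ : iid_uniform01 Z.

Local Notation E f := (\int[P]_w f w).
Local Notation sigma_others l := (g_sigma_algebraType (other_cylinders Z l)).

Definition unif (i : 'I_n) (w : T) : R := clip01 (Z i w).
Definition gt_ind (i j : 'I_n) (w : T) : R := (Z j w < Z i w)%R%:R.

Lemma bounded_rv_comp (b : R -> R) i :
  measurable_fun setT b -> (forall v, 0 <= b v <= 1) ->
  bounded_rv (fun w => b (Z i w)).
Proof.
move=> mb b01; split; first by apply: measurableT_comp.
by exists 1 => w; have /andP[b0 b1] := b01 (Z i w); rewrite ger0_norm.
Qed.

Lemma clip01_bounds (v : R) : 0 <= clip01 v <= 1.
Proof. by rewrite clip01_ge0 clip01_le1. Qed.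

Lemma bounded_rv_unif i : bounded_rv (unif i).
Proof. exact: (bounded_rv_comp i measurable_clip01 clip01_bounds). Qed.

Lemma bounded_rv_gt_ind i j : bounded_rv (gt_ind i j).
Proof.
split; first by apply: measurable_ltr_natr.
by exists 1 => w; rewrite /gt_ind; case: (_ < _); rewrite ?normr1 ?normr0.
Qed.

Lemma integral_distribution_unif l (f : R -> R) :
  measurable_fun setT f -> (forall v, 0 <= f v) ->
  (\int[distribution P (Z l)]_v (f v)%:E =
   \int[uniform_prob (@ltr01 R)]_v (f v)%:E)%E.
Proof.
move=> mf f0.
(* [R] carries its Borel sets under two measure displays; the identity
   transports one structure to the other. *)
have mid : @measurable_fun _ default_measure_display (measurableTypeR R) R
    setT idfun.
  by move=> _ B mB; rewrite setTI.
pose I := @mfun_Sub _ default_measure_display (measurableTypeR R) R idfun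
  (mem_set mid).
transitivity (\int[distribution (uniform_prob (@ltr01 R)) I]_v (f v)%:E)%E.
  by apply: eq_measure_integral => A mA _; exact: HZ.2.
by rewrite ge0_integral_distribution//; exact/measurable_EFinP.
Qed.

(** The working form of Tonelli: [g] is the inner integral in closed form, so each use reduces to a
    one-dimensional uniform integral with the other variables fixed. *)
Lemma mean_integrate_out l (h : T -> R -> R) (g : T -> R) :
  measurable_fun [set: (sigma_others l * R)%type]
    (fun x : sigma_others l * R => h x.1 x.2) ->
  (forall w v, 0 <= h w v) ->
  (forall w, \int[uniform_prob (@ltr01 R)]_v (h w v)%:E = (g w)%:E)%E ->
  E (fun w => h w (Z l w)) = E g.
Proof.
move=> mh h0 hg; rewrite /Rintegral (integrate_out HZ.1 mh h0).
congr fine; apply: eq_integral => w _.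
rewrite integral_distribution_unif ?hg//.
exact: (measurableT_comp mh (@pair1_measurable _ _ (sigma_others l) R w)).
Qed.

Lemma measurable_fst_others l i : i != l ->
  measurable_fun [set: (sigma_others l * R)%type]
    (fun x : sigma_others l * R => Z i x.1).
Proof.
move=> il; have h := @measurable_sigma_others _ _ _ P n Z l i il.
pose S : measurableType _ := sigma_others l.
exact: (@measurableT_comp _ _ _ (S * R)%type S R (fun x => Z i x) setT fst h
  (@measurable_fst _ _ S R)).
Qed.

Lemma mean_unif_exp i k : E (fun w => unif i w ^+ k) = k.+1%:R^-1.
Proof.
rewrite (@mean_integrate_out i (fun _ v => clip01 v ^+ k) (fun=> k.+1%:R^-1)).
- exact: mean_cst.
- apply: measurable_funX; apply: (measurableT_comp measurable_clip01).
  exact: measurable_snd.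
- by move=> w v; rewrite exprn_ge0// clip01_ge0.
- by move=> w; exact: uniform01_moment.
Qed.

Section OneFactor.
Variable b : R -> R.
Hypotheses (mb : measurable_fun setT b) (b01 : forall v, 0 <= b v <= 1).

Let b0 v : 0 <= b v. Proof. by have /andP[] := b01 v. Qed.

(** Integrating out [Z j] replaces the indicator by the distribution function at [Z i]. The test
    function [b] is later the constant 1, [clip01], or the indicator of a Borel set; its bounds give
    the positivity for Tonelli and integrability. *)
Lemma mean_gt_ind_l i j : i != j ->
  E (fun w => b (Z i w) * gt_ind i j w) = E (fun w => b (Z i w) * unif i w).
Proof.
move=> ij; apply: (mean_integrate_out (l := j)
  (h := fun w v => b (Z i w) * (v < Z i w)%R%:R)).
- apply: measurable_funM.
    by apply: (measurableT_comp mb); exact: measurable_fst_others.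
  apply: measurable_ltr_natr; first exact: measurable_snd.
  exact: measurable_fst_others.
- by move=> w v; rewrite mulr_ge0.
- move=> w; under eq_integral do rewrite EFinM.
  rewrite ge0_integralZl//= ?uniform01_lt ?lee_fin//.
  by apply/measurable_EFinP; apply: measurable_ltr_natr.
Qed.

Lemma mean_gt_ind_r i j : i != j ->
  E (fun w => b (Z j w) * gt_ind i j w) =
  E (fun w => b (Z j w) * (1 - unif j w)).
Proof.
rewrite eq_sym => ij; apply: (mean_integrate_out (l := i)
  (h := fun w v => b (Z j w) * (Z j w < v)%R%:R)).
- apply: measurable_funM.
    by apply: (measurableT_comp mb); exact: measurable_fst_others.
  apply: measurable_ltr_natr; last exact: measurable_snd.
  exact: measurable_fst_others.
- by move=> w v; rewrite mulr_ge0.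
- move=> w; under eq_integral do rewrite EFinM.
  rewrite ge0_integralZl//= ?uniform01_gt ?lee_fin//.
  by apply/measurable_EFinP; apply: measurable_ltr_natr.
Qed.

Lemma mean_unif_other i k : k != i ->
  E (fun w => b (Z k w) * unif i w) = E (fun w => b (Z k w)) / 2.
Proof.
move=> ki; transitivity (E (fun w => 2^-1 * b (Z k w))); last first.
  by rewrite meanZ 1?mulrC//; exact: bounded_rv_comp.
apply: (mean_integrate_out (l := i) (h := fun w v => b (Z k w) * clip01 v)).
- apply: measurable_funM.
    by apply: (measurableT_comp mb); exact: measurable_fst_others.
  by apply: (measurableT_comp measurable_clip01); exact: measurable_snd.
- by move=> w v; rewrite mulr_ge0// clip01_ge0.
- move=> w; under eq_integral do rewrite EFinM.
  rewrite ge0_integralZl//= ?lee_fin//.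
  + by have := @uniform01_moment R 1; under eq_integral do rewrite expr1;
      move=> ->; rewrite -EFinM mulrC.
  + by apply/measurable_EFinP; exact: measurable_clip01.
  + by move=> v _; rewrite lee_fin clip01_ge0.
Qed.

(** Integrating out [Z j] leaves [unif i], which is independent of [Z k] and has mean 1/2. *)
Lemma mean_gt_ind_other i j k : i != j -> k != i -> k != j ->
  E (fun w => b (Z k w) * gt_ind i j w) = E (fun w => b (Z k w)) / 2.
Proof.
move=> ij ki kj; rewrite -(mean_unif_other ki).
apply: (mean_integrate_out (l := j)
  (h := fun w v => b (Z k w) * (v < Z i w)%R%:R)).
- apply: measurable_funM.
    by apply: (measurableT_comp mb); exact: measurable_fst_others.
  apply: measurable_ltr_natr; first exact: measurable_snd.
  exact: measurable_fst_others.
- by move=> w v; rewrite mulr_ge0.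
- move=> w; under eq_integral do rewrite EFinM.
  rewrite ge0_integralZl//= ?uniform01_lt ?lee_fin//.
  by apply/measurable_EFinP; apply: measurable_ltr_natr.
Qed.

End OneFactor.

Lemma mean_unif i : E (unif i) = 2^-1.
Proof.
by rewrite -(mean_unif_exp i 1); under [RHS]eq_Rintegral do rewrite expr1.
Qed.

Lemma mean_unif_sqr i : E (fun w => unif i w ^+ 2) = 3^-1.
Proof. exact: mean_unif_exp. Qed.

(** For [U] uniform the three values are [E U^2 = 1/3], [E U(1-U) = 1/6] and [(E U)/2 = 1/4]; the
    first two differ from 1/4 by plus and minus 1/12. *)
Lemma mean_unif_gt_ind i j k : i != j ->
  E (fun w => unif k w * gt_ind i j w) =
    4^-1 + ((k == i)%:R - (k == j)%:R) / 12.
Proof.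
move=> ij.
have [->|ki] := eqVneq k i.
  rewrite (negbTE ij).
  rewrite (mean_gt_ind_l measurable_clip01 clip01_bounds ij).
  rewrite -/(unif i _); under eq_Rintegral do rewrite -expr2.
  by rewrite mean_unif_sqr /=; lra.
have [->|kj] := eqVneq k j.
  rewrite (mean_gt_ind_r measurable_clip01 clip01_bounds ij).
  under eq_Rintegral do rewrite mulrBr mulr1 -expr2.
  rewrite meanB ?mean_unif_sqr; last 2 first.
  - exact: bounded_rv_unif.
  - by under eq_fun do rewrite expr2; apply: bounded_rvM; exact: bounded_rv_unif.
  by rewrite mean_unif /=; lra.
rewrite (mean_gt_ind_other measurable_clip01 clip01_bounds ij ki kj).
by rewrite mean_unif /=; lra.
Qed.

Lemma mean_gt_ind i j : i != j -> E (gt_ind i j) = 2^-1.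
Proof.
move=> ij; rewrite -(mean_unif i).
have b1 (v : R) : 0 <= (fun=> 1 : R) v <= 1 by rewrite ler01 lexx.
have := @mean_gt_ind_l (fun=> 1) (measurable_cst _) b1 i j ij.
under eq_Rintegral do rewrite mul1r.
by under [RHS]eq_Rintegral do rewrite mul1r.
Qed.

(** The hypotheses leave only disjoint pairs, with value 1/4, and chains of three indices, with
    value [1/4 - 1/12 = 1/6]: the probability of one prescribed order of three uniform variables. *)
Lemma mean_gt_ind2 i j k l : i != j -> k != l -> k != i -> l != j -> 
  ~~ ((l == i) && (j == k)) ->
  E (fun w => gt_ind i j w * gt_ind k l w) =
    4^-1 - ((j == k)%:R + (i == l)%:R) / 12.
Proof.
(* If [l = i], exchanging the two indicators makes the last index differ from the three others. Then
   [Z l'] occurs in one indicator only and can be integrated out. *)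
suff H i' j' k' l' : i' != j' -> k' != l' -> k' != i' -> l' != j' -> l' != i' ->
    E (fun w => gt_ind i' j' w * gt_ind k' l' w) = 4^-1 - (j' == k')%:R / 12.
  move=> ij kl ki lj; have [li|li] := eqVneq l i.
    rewrite /= => jk; under eq_Rintegral do rewrite mulrC.
    rewrite H ?li ?eqxx// 1?eq_sym//.
    by rewrite eq_sym (negbTE jk) add0r.
  by move=> _; rewrite H// addr0 eq_sym.
move=> ij kl ki lj li {i j k l}.
transitivity (E (fun w => gt_ind i' j' w * unif k' w)).
  apply: (mean_integrate_out (l := l')
    (h := fun w v => gt_ind i' j' w * (v < Z k' w)%R%:R)).
  - apply: measurable_funM; apply: measurable_ltr_natr;
      try (apply: measurable_fst_others; by rewrite // eq_sym).
    exact: measurable_snd.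
  - by move=> w v; rewrite mulr_ge0.
  - move=> w; under eq_integral do rewrite EFinM.
    rewrite ge0_integralZl//= ?uniform01_lt ?lee_fin//.
    by apply/measurable_EFinP; apply: measurable_ltr_natr.
under eq_Rintegral do rewrite mulrC.
by rewrite mean_unif_gt_ind// (negbTE ki) sub0r mulNr (eq_sym j').
Qed.

End UniformSample.

(** * Almost sure uniqueness of conditional expectations and its effect on covariances *)

Section ConditionalExpectation.
Context {d : measure_display} {T : measurableType d} {R : realType}.
Variable P : probability T R.

Local Notation E f := (\int[P]_w f w).

Lemma bounded_rv_indic (A : set T) : measurable A ->
  bounded_rv (\1_A : T -> R).
Proof.
move=> mA; split; first exact: measurable_indic.
by exists 1 => w; rewrite indicE; case: (_ \in _); rewrite ?normr1 ?normr0.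
Qed.

Lemma integral_setE (A : set T) (f : T -> R) : measurable A -> bounded_rv f ->
  (\int[P]_(w in A) (f w)%:E = (E (fun w => (\1_A w * f w)%R))%:E)%E.
Proof.
move=> mA bf.
have b1 : bounded_rv (fun w => \1_A w * f w : R).
  by apply: bounded_rvM => //; exact: bounded_rv_indic.
rewrite fineK; last exact: integrable_fin_num (bounded_rv_integrable P b1).
rewrite (integral_mkcond A); apply: eq_integral => w _.
by rewrite patchE indicE; case: (_ \in _); rewrite ?mul1r ?mul0r.
Qed.

(** The event where [Y1 < Y2] belongs to the sigma-algebra of [W], so both versions have the same
    integral on it as [X]. The positive difference [Y2 - Y1] then integrates to zero there, and the
    event is null. *)
Lemma cond_expectation_ge (X Y1 Y2 : T -> R) (W : {RV P >-> R}) :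
  is_cond_expectation X W Y1 -> is_cond_expectation X W Y2 ->
  {ae P, forall w, Y2 w <= Y1 w}.
Proof.
move=> [iY1 sY1 XY1] [iY2 sY2 XY2].
pose S : measurableType _ := g_sigma_algebra_preimageType W.
have mS1 : measurable_fun [set: S] (Y1 : S -> R).
  by move=> _ B mB; rewrite setTI; exact: sY1.
have mS2 : measurable_fun [set: S] (Y2 : S -> R).
  by move=> _ B mB; rewrite setTI; exact: sY2.
pose A := [set w | Y1 w < Y2 w].
have sA : preimage_set_system setT W measurable A.
  have := @measurable_fun_ltr _ S R setT Y1 Y2 mS1 mS2 measurableT
    [set true] Logic.I.
  by rewrite setTI.
have mA : measurable A.
  case: sA => B mB <-; exact: measurable_funPT.
have iA1 : P.-integrable A (EFin \o Y1) by apply: integrableS iY1.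
have iA2 : P.-integrable A (EFin \o Y2) by apply: integrableS iY2.
have int0 : (\int[P]_(w in A) `|(Y2 w - Y1 w)%:E| = 0)%E.
  transitivity (\int[P]_(w in A) ((Y2 w)%:E - (Y1 w)%:E))%E.
    apply: eq_integral => w; rewrite inE => Aw.
    by rewrite gee0_abs ?EFinB// lee_fin subr_ge0 ltW.
  rewrite integralB// XY1// XY2// subee//.
  rewrite -XY1//; exact: integrable_fin_num.
have := ae_eq_integral_abs P mA (_ : measurable_fun A (EFin \o (Y2 \- Y1))).
case; first by apply: measurable_int (integrableB mA iA2 iA1).
move=> /(_ int0) + _; apply: filterS => w /= Aw0.
rewrite leNgt; apply/negP => Aw; have := Aw0 Aw.
by case => /eqP; rewrite subr_eq0 => /eqP E12; move: Aw; rewrite E12 ltxx.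
Qed.

Lemma cond_expectation_ae_unique (X Y1 Y2 : T -> R) (W : {RV P >-> R}) :
  is_cond_expectation X W Y1 -> is_cond_expectation X W Y2 ->
  {ae P, forall w, Y1 w = Y2 w}.
Proof.
move=> c1 c2.
apply: filterS2 (cond_expectation_ge c1 c2) (cond_expectation_ge c2 c1).
by move=> w le21 le12; apply/eqP; rewrite eq_le le12.
Qed.

(** This makes the correlation independent of the chosen versions, so an arbitrary Hajek projection
    can be replaced by the explicit affine one. *)
Lemma covariance_ae_eq (X1 X2 Y1 Y2 : T -> R) :
  measurable_fun setT X1 -> measurable_fun setT X2 ->
  measurable_fun setT Y1 -> measurable_fun setT Y2 ->
  {ae P, forall w, X1 w = X2 w} -> {ae P, forall w, Y1 w = Y2 w} ->
  covariance P X1 Y1 = covariance P X2 Y2.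
Proof.
move=> mX1 mX2 mY1 mY2 eX eY.
have eE (F G : T -> R) : measurable_fun setT F -> measurable_fun setT G ->
    {ae P, forall w, F w = G w} -> 'E_P[F]%E = 'E_P[G]%E.
  move=> mF mG FG; rewrite unlock; apply: ae_eq_integral => //.
  - exact/measurable_EFinP.
  - exact/measurable_EFinP.
  - by apply: filterS FG => w FGw _ /=; rewrite FGw.
rewrite unlock /covariance (eE _ _ mX1 mX2 eX) (eE _ _ mY1 mY2 eY).
apply: eE.
- by apply: measurable_funM; apply: measurable_funB.
- by apply: measurable_funM; apply: measurable_funB.
- apply: filterS2 eX eY => w eXw eYw.
  change ((X1 w - fine 'E_P[X2]%E) * (Y1 w - fine 'E_P[Y2]%E) =
    (X2 w - fine 'E_P[X2]%E) * (Y2 w - fine 'E_P[Y2]%E)).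
  by rewrite eXw eYw.
Qed.

End ConditionalExpectation.

(** * The Hajek projection of the inversion statistic *)

Section HajekProjection.
Context {d : measure_display} {T : measurableType d} {R : realType}.
Variables (P : probability T R) (n : nat) (Z : 'I_n -> {RV P >-> R}).
Hypothesis HZ : iid_uniform01 Z.

Local Notation E f := (\int[P]_w f w).

Definition pair_sign (i j k : 'I_n) : R := (k == i)%:R - (k == j)%:R.

(** One affine expression covers the three forms of [E(1{Z_i > Z_j} | Z_k)]: [U_k] for slope 1,
    [1 - U_k] for slope -1, and 1/2 for slope 0. The intercept [(1 - s)/2] is forced by the mean
    1/2. *)
Lemma mean_factor_gt_ind (b : R -> R) i j k :
  measurable_fun setT b -> (forall v, 0 <= b v <= 1) -> i != j ->
  E (fun w => b (Z k w) * gt_ind Z i j w) =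
  E (fun w => b (Z k w) *
    (pair_sign i j k * unif Z k w + (1 - pair_sign i j k) / 2)).
Proof.
move=> mb b01 ij; rewrite /pair_sign.
have [->|ki] := eqVneq k i.
  rewrite (negbTE ij) (mean_gt_ind_l HZ mb b01 ij).
  by apply: eq_Rintegral => w _; rewrite subr0 mul1r subrr mul0r addr0.
have [->|kj] := eqVneq k j.
  rewrite (mean_gt_ind_r HZ mb b01 ij).
  by apply: eq_Rintegral => w _ /=; congr (_ * _); lra.
rewrite (mean_gt_ind_other HZ mb b01 ij ki kj).
under [RHS]eq_Rintegral do rewrite subrr mul0r add0r subr0 mul1r mulrC.
by rewrite meanZ 1?mulrC//; exact: (bounded_rv_comp Z k mb b01).
Qed.

Definition inv_coef (d1 : nat) (k : 'I_n) : R :=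
  \sum_(i < n) \sum_(j < n | (i < j)%N && (j - i <= d1)%N) pair_sign i j k.

Definition inv_const (d1 : nat) (k : 'I_n) : R :=
  \sum_(i < n) \sum_(j < n | (i < j)%N && (j - i <= d1)%N)
    (1 - pair_sign i j k) / 2.

Lemma bounded_rv_X_inv d1 : bounded_rv (X_inv d1 Z).
Proof.
by apply: bounded_rv_sum => i _; apply: bounded_rv_sum => j _;
  exact: bounded_rv_gt_ind.
Qed.

(** Events of the sigma-algebra of [Z k] are preimages of Borel sets [B], so the averaging property
    is the preceding identity with [b] the indicator of [B], summed over the windowed pairs. *)
Lemma cond_expectation_X_inv d1 k :
  is_cond_expectation (X_inv d1 Z) (Z k)
    (fun w => inv_coef d1 k * unif Z k w + inv_const d1 k).
Proof.
have bY : bounded_rv (fun w => inv_coef d1 k * unif Z k w + inv_const d1 k).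
  apply: bounded_rvD; last exact: bounded_rv_cst.
  by apply: bounded_rvZ; exact: bounded_rv_unif.
split; first exact: bounded_rv_integrable.
- move=> B mB.
  exists ((fun v => inv_coef d1 k * clip01 v + inv_const d1 k) @^-1` B).
    rewrite -[X in measurable X]setTI.
    have m : measurable_fun setT
        (fun v : R => inv_coef d1 k * clip01 v + inv_const d1 k).
      apply: measurable_funD; last exact: measurable_cst.
      by apply: measurable_funM; [exact: measurable_cst|exact: measurable_clip01].
    exact: m.
  by rewrite setTI.
- move=> A [B mB]; rewrite setTI => AB.
  have mA : measurable A.
    by rewrite -AB -[X in measurable X]setTI; exact: measurable_funPT.
  rewrite !integral_setE//; last exact: bounded_rv_X_inv.
  congr EFin.
  have mb : measurable_fun setT (\1_B : R -> R) by exact: measurable_indic.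
  have b01 (v : R) : 0 <= (\1_B v : R) <= 1.
    by rewrite indicE; case: (_ \in _); rewrite ?lexx ?ler01.
  have bA : (\1_A : T -> R) = fun w => \1_B (Z k w).
    by apply/funext => w; rewrite -AB !indicE.
  rewrite bA.
  transitivity (\sum_(i < n) \sum_(j < n | (i < j)%N && (j - i <= d1)%N)
    E (fun w => \1_B (Z k w) *
      (pair_sign i j k * unif Z k w + (1 - pair_sign i j k) / 2))).
    have bt i j : bounded_rv (fun w => \1_B (Z k w) *
        (pair_sign i j k * unif Z k w + (1 - pair_sign i j k) / 2)).
      apply: bounded_rvM; first exact: (bounded_rv_comp Z k mb b01).
      apply: bounded_rvD; last exact: bounded_rv_cst.
      by apply: bounded_rvZ; exact: bounded_rv_unif.
    under [RHS]eq_bigr do rewrite -mean_sum//.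
    rewrite -mean_sum; last by move=> i _; exact: bounded_rv_sum.
    apply: eq_Rintegral => w _.
    rewrite /inv_coef /inv_const mulr_suml -big_split mulr_sumr.
    apply: eq_bigr => i _; rewrite /= mulr_suml -big_split mulr_sumr.
    by apply: eq_bigr => j _.
  under eq_bigr => i _.
    under eq_bigr => j ij.
      rewrite -mean_factor_gt_ind//; last first.
        by have /andP[+ _] := ij; apply: contraTneq => ->; rewrite ltnn.
      over.
    over.
  have bt i j : bounded_rv (fun w => \1_B (Z k w) * gt_ind Z i j w).
    apply: bounded_rvM; last exact: bounded_rv_gt_ind.
    exact: (bounded_rv_comp Z k mb b01).
  under eq_bigr do rewrite -mean_sum//.
  rewrite -mean_sum; last by move=> i _; exact: bounded_rv_sum.
  apply: eq_Rintegral => w _; rewrite /X_inv mulr_sumr.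
  by apply: eq_bigr => i _; rewrite mulr_sumr.
Qed.

(** Measurability is read off the defining formula, which holds everywhere, since almost sure
    equality alone would not give it. The explicit form holds off a finite union of null sets, one
    for each [k]. *)
Lemma Hajek_projection_X_inv d1 Xhat :
  is_Hajek_projection Z (X_inv d1 Z) Xhat ->
  measurable_fun setT Xhat /\
  exists C, {ae P, forall w,
    Xhat w = \sum_(k < n) inv_coef d1 k * unif Z k w + C}.
Proof.
move=> [Y [HY XhatE]]; split.
  rewrite (funext XhatE).
  apply: measurable_funB; last exact: measurable_cst.
  apply: measurable_sum => k; have [iY _ _] := HY k.
  exact/measurable_EFinP/(measurable_int P).
exists (\sum_(k < n) inv_const d1 k - (n%:R - 1) * fine ('E_P[X_inv d1 Z])%E).
have : {ae P, forall w, forall k, 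
    Y k w = inv_coef d1 k * unif Z k w + inv_const d1 k}.
  apply: filter_forall => k.
  exact: cond_expectation_ae_unique (HY k) (cond_expectation_X_inv d1 k).
apply: filterS => w Yw; rewrite XhatE addrA -big_split; congr (_ - _).
by apply: eq_bigr => k _; rewrite Yw.
Qed.

End HajekProjection.

(** * The covariance and the two variances as finite sums *)

Section Moments.
Context {d : measure_display} {T : measurableType d} {R : realType}.
Variables (P : probability T R) (n : nat) (Z : 'I_n -> {RV P >-> R}).
Hypothesis HZ : iid_uniform01 Z.

Local Notation E f := (\int[P]_w f w).

Lemma mean_sum_mul (I J : finType) (A : pred I) (B : pred J)
    (F : I -> T -> R) (G : J -> T -> R) :
  (forall i, bounded_rv (F i)) -> (forall j, bounded_rv (G j)) ->
  E (fun w => (\sum_(i | A i) F i w) * (\sum_(j | B j) G j w)) =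
  \sum_(i | A i) \sum_(j | B j) E (fun w => F i w * G j w).
Proof.
move=> bF bG.
have bFG i j : bounded_rv (fun w => F i w * G j w) by exact: bounded_rvM.
under [RHS]eq_bigr do rewrite -mean_sum//.
rewrite -mean_sum; last by move=> i _; exact: bounded_rv_sum.
apply: eq_Rintegral => w _; rewrite mulr_suml.
by apply: eq_bigr => i _; rewrite mulr_sumr.
Qed.

Lemma mean_centered_mul (f g : T -> R) : bounded_rv f -> bounded_rv g ->
  E (fun w => (f w - E f) * (g w - E g)) = E (fun w => f w * g w) - E f * E g.
Proof.
move=> bf bg; have bfg := bounded_rvM bf bg.
transitivity (E (fun w => f w * g w - (E g * f w + E f * g w - E f * E g))).
  by apply: eq_Rintegral => w _; ring.
have bg' c : bounded_rv (fun w => c * g w) by exact: bounded_rvZ.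
have bf' c : bounded_rv (fun w => c * f w) by exact: bounded_rvZ.
have bD : bounded_rv (fun w => E g * f w + E f * g w).
  exact: (bounded_rvD (bf' _) (bg' _)).
have bc : @bounded_rv _ T R (fun=> E f * E g) by exact: bounded_rv_cst.
rewrite (meanB P bfg (bounded_rvB bD bc)) (meanB P bD bc).
rewrite (meanD P (bf' _) (bg' _)) mean_cst (meanZ P _ bf) (meanZ P _ bg); ring.
Qed.

(** Bilinearity with two index types, so that it serves sums over single indices (the projection)
    and over pairs (the descents) alike; the additive constants cancel on centering. *)
Lemma covariance_linear_combinations (I J : finType) (A : pred I) (B : pred J)
    (x : I -> R) (y : J -> R) (F : I -> T -> R) (G : J -> T -> R) C D :
  (forall i, bounded_rv (F i)) -> (forall j, bounded_rv (G j)) ->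
  fine (covariance P (fun w => \sum_(i | A i) x i * F i w + C)
    (fun w => \sum_(j | B j) y j * G j w + D)) =
  \sum_(i | A i) \sum_(j | B j)
    x i * y j * (E (fun w => F i w * G j w) - E (F i) * E (G j)).
Proof.
move=> bF bG; rewrite covariance_mean.
have bxF i : bounded_rv (fun w => x i * F i w) by exact: bounded_rvZ.
have byG j : bounded_rv (fun w => y j * G j w) by exact: bounded_rvZ.
have EF : E (fun w => \sum_(i | A i) x i * F i w + C) =
    \sum_(i | A i) x i * E (F i) + C.
  rewrite meanD; [|exact: bounded_rv_sum|exact: bounded_rv_cst].
  rewrite mean_cst mean_sum//; congr (_ + _).
  by apply: eq_bigr => i _; rewrite meanZ.
have EG : E (fun w => \sum_(j | B j) y j * G j w + D) =
    \sum_(j | B j) y j * E (G j) + D.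
  rewrite meanD; [|exact: bounded_rv_sum|exact: bounded_rv_cst].
  rewrite mean_cst mean_sum//; congr (_ + _).
  by apply: eq_bigr => j _; rewrite meanZ.
rewrite EF EG.
transitivity (E (fun w => (\sum_(i | A i) x i * (F i w - E (F i))) *
    (\sum_(j | B j) y j * (G j w - E (G j))))).
  apply: eq_Rintegral => w _; congr (_ * _).
    rewrite [RHS](eq_bigr _ (fun i _ => mulrBr _ _ _)) sumrB.
    by rewrite opprD addrACA subrr addr0.
  rewrite [RHS](eq_bigr _ (fun i _ => mulrBr _ _ _)) sumrB.
  by rewrite opprD addrACA subrr addr0.
have cF i : bounded_rv (fun w => F i w - E (F i)).
  by apply: bounded_rvB => //; exact: bounded_rv_cst.
have cG j : bounded_rv (fun w => G j w - E (G j)).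
  by apply: bounded_rvB => //; exact: bounded_rv_cst.
rewrite mean_sum_mul; [|by move=> i; exact: bounded_rvZ..].
apply: eq_bigr => i _; apply: eq_bigr => j _.
rewrite -mean_centered_mul// -meanZ; last exact: bounded_rvM.
by apply: eq_Rintegral => w _; rewrite mulrACA.
Qed.

Definition des_pair (d2 : nat) (p : 'I_n * 'I_n) := p.2 == (p.1 + d2)%N :> nat.

(** The factor 1 and the summand 0 put the statistic in the shape required by the bilinearity
    lemma. *)
Lemma X_des_pairs d2 :
  X_des d2 Z = fun w => \sum_(p | des_pair d2 p) 1 * gt_ind Z p.1 p.2 w + 0.
Proof.
apply/funext => w; rewrite addr0; under eq_bigr do rewrite mul1r.
by rewrite /X_des pair_big_dep.
Qed.

Lemma des_pair_neq d2 p : (0 < d2)%N -> des_pair d2 p -> p.1 != p.2.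
Proof.
move=> d0 /eqP p2; apply/negP => /eqP p12.
by move: p2; rewrite p12; lia.
Qed.

Section Hajek.
Variables (d1 : nat) (Xhat : T -> R).
Hypothesis HXhat : is_Hajek_projection Z (X_inv d1 Z) Xhat.

Lemma measurable_X_des d2 : measurable_fun setT (X_des d2 Z).
Proof.
suff [] : bounded_rv (X_des d2 Z) by [].
by apply: bounded_rv_sum => i _; apply: bounded_rv_sum => j _;
  exact: bounded_rv_gt_ind.
Qed.

Lemma measurable_lin (x : 'I_n -> R) C :
  measurable_fun setT (fun w => \sum_k x k * unif Z k w + C).
Proof.
suff [] : bounded_rv (fun w => \sum_k x k * unif Z k w + C) by [].
apply: bounded_rvD; last exact: bounded_rv_cst.
apply: bounded_rv_sum => k _.
by apply: bounded_rvZ; exact: bounded_rv_unif.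
Qed.

(** Each descent indicator is correlated only with the two variables it compares, with opposite
    signs, so the sum over [k] collapses to a difference of two coefficients. *)
Lemma covariance_Hajek_X_des d2 : (0 < d2)%N ->
  fine (covariance P Xhat (X_des d2 Z)) =
  (\sum_(p | des_pair d2 p)
     (@inv_coef R n d1 p.1 - @inv_coef R n d1 p.2)) / 12.
Proof.
move=> d0; have [mX [C XC]] := Hajek_projection_X_inv HZ HXhat.
rewrite (covariance_ae_eq mX (measurable_lin _ C) (measurable_X_des d2)
  (measurable_X_des d2) XC); last by exact: aeW.
rewrite X_des_pairs covariance_linear_combinations; last 2 first.
- by move=> i; exact: bounded_rv_unif.
- by move=> p; exact: bounded_rv_gt_ind.
rewrite exchange_big mulr_suml; apply: eq_bigr => p /(des_pair_neq d0) pE.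
under eq_bigr do rewrite mean_unif_gt_ind// mean_unif// mean_gt_ind//.
have sumE q : \sum_k @inv_coef R n d1 k * (k == q)%:R = @inv_coef R n d1 q.
  rewrite (bigD1 q)//= eqxx mulr1 big1 ?addr0// => k /negbTE ->.
  by rewrite mulr0.
rewrite -{1}(sumE p.1) -(sumE p.2) -sumrB mulr_suml.
by apply: eq_bigr => k _; field.
Qed.

Lemma mean_unif_mul k l :
  E (fun w => unif Z k w * unif Z l w) = 4^-1 + (k == l)%:R / 12.
Proof.
have [->|kl] := eqVneq k l.
  under eq_Rintegral do rewrite -expr2.
  by rewrite mean_unif_sqr//=; lra.
rewrite (mean_unif_other HZ measurable_clip01 (@clip01_bounds R) kl).
by rewrite (mean_unif HZ k) /=; lra.
Qed.

Lemma variance_Hajek :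
  fine (variance P Xhat) = (\sum_k (@inv_coef R n d1 k) ^+ 2) / 12.
Proof.
have [mX [C XC]] := Hajek_projection_X_inv HZ HXhat.
rewrite /variance (covariance_ae_eq mX (measurable_lin _ C) mX
  (measurable_lin _ C) XC XC).
rewrite covariance_linear_combinations; last 2 first.
- by move=> i; exact: bounded_rv_unif.
- by move=> i; exact: bounded_rv_unif.
rewrite mulr_suml; apply: eq_bigr => k _.
under eq_bigr do rewrite mean_unif_mul !mean_unif//.
rewrite (bigD1 k)//= eqxx big1 => [|l /negbTE lk]; last first.
  by rewrite eq_sym lk /=; field.
by rewrite addr0 /=; field.
Qed.

(** A pair contributes its own variance [1/2 - 1/4], two pairs forming a chain contribute -1/12, and
    disjoint pairs contribute nothing. *)
Lemma variance_X_des d2 : (0 < d2)%N ->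
  fine (variance P (X_des d2 Z)) =
  \sum_(p | des_pair d2 p) \sum_(q | des_pair d2 q)
    ((p == q)%:R / 4 - ((p.2 == q.1)%:R + (p.1 == q.2)%:R) / 12).
Proof.
move=> d0; rewrite /variance X_des_pairs covariance_linear_combinations.
2, 3: by move=> p; exact: bounded_rv_gt_ind.
apply: eq_bigr => -[i j] Hp; apply: eq_bigr => -[k l] Hq /=.
have ij := des_pair_neq d0 Hp; have kl := des_pair_neq d0 Hq.
rewrite !mul1r !mean_gt_ind//.
have [pq|pq] := eqVneq (i, j) (k, l).
  case: pq => <- <-; rewrite (negbTE ij) eq_sym (negbTE ij) /=.
  transitivity (E (gt_ind Z i j) - 2^-1 * 2^-1).
    congr (_ - _); apply: eq_Rintegral => w _.
    by rewrite /gt_ind -natrM mulnb andbb.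
  by rewrite mean_gt_ind//; lra.
move: Hp Hq => /eqP /= jE /eqP /= lE.
(* With a common shift, distinct pairs have distinct left ends and distinct right ends, so they can
   only meet end to start. Meeting at both ends would force the shift to be zero. *)
have ki : k != i.
  apply: contraNneq pq => ki; rewrite ki; apply/eqP; congr (_, _).
  by apply: val_inj; rewrite /= jE lE ki.
have lj : l != j.
  apply: contraNneq pq => lj; rewrite lj; apply/eqP; congr (_, _).
  by apply: val_inj => /=; apply/eqP; rewrite -(eqn_add2r d2) -jE -lE lj.
rewrite mean_gt_ind2//.
  by rewrite /=; lra.
apply/negP => /andP[/eqP li /eqP jk].
by move: jE lE; rewrite li jk; lia.
Qed.

End Hajek.
End Moments.

(** * Closed forms of the sums over indices *)

Section Sums.
Context {R : realType}.

Lemma sum_ord_itv (n a b : nat) :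
  (\sum_(j < n | (a <= j < b)%N) 1 = minn n b - a)%N.
Proof.
elim: n => [|n IH]; first by rewrite big_ord0; lia.
by rewrite big_mkcond big_ord_recr /= -big_mkcond IH; case: ifP; lia.
Qed.

(* [d - k] is truncated: [min(d, x) = d - (d - x)], so this is the number of
   inversion pairs to the right of [k] minus the number to its left. *)
Lemma inv_coefE (n d : nat) (k : 'I_n) :
  @inv_coef R n d k = (d - k)%:R - (d - (n.-1 - k))%:R.
Proof.
have kn := ltn_ord k.
transitivity ((\sum_(j < n | (k < j)%N && (j - k <= d)%N) 1)%:R -
  (\sum_(i < n | (i < k)%N && (k - i <= d)%N) 1)%:R : R).
  rewrite /inv_coef /pair_sign !natr_sum.
  under [LHS]eq_bigr do rewrite sumrB.
  rewrite sumrB; congr (_ - _).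
    rewrite (bigD1 k)//= [X in _ + X]big1 ?addr0.
      by apply: eq_bigr => j _; rewrite eqxx.
    move=> i ik; apply: big1 => j _; by rewrite eq_sym (negbTE ik).
  rewrite [RHS]big_mkcond; apply: eq_bigr => i _.
  rewrite big_mkcond (bigD1 k)//= eqxx big1 ?addr0// => j /negbTE jk.
  by rewrite eq_sym jk if_same.
have -> : (\sum_(j < n | (k < j)%N && (j - k <= d)%N) 1 =
    minn n (k + d).+1 - k.+1)%N.
  by rewrite -sum_ord_itv; apply: eq_bigl => j; lia.
have -> : (\sum_(i < n | (i < k)%N && (k - i <= d)%N) 1 =
    minn n k - (k - d))%N.
  by rewrite -sum_ord_itv; apply: eq_bigl => j; lia.
apply/eqP; rewrite subr_eq addrAC eq_sym subr_eq -!natrD; apply/eqP.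
by congr _%:R; lia.
Qed.

Lemma sum_des_pair (n d : nat) (F : nat -> nat -> R) : (d <= n)%N ->
  \sum_(p : 'I_n * 'I_n | des_pair d p) F p.1 p.2 =
  \sum_(i < n - d) F i (i + d)%N.
Proof.
move=> dn; rewrite -(pair_big_dep xpredT
  (fun i j : 'I_n => j == (i + d)%N :> nat) (fun i j => F i j))/=.
rewrite (big_ord_widen n (fun i => F i (i + d)%N) (leq_subr d n)) [RHS]big_mkcond.
apply: eq_bigr => i _; case: ifPn => id.
  have idn : (i + d < n)%N by lia.
  rewrite (bigD1 (Ordinal idn))//= big1 ?addr0// => j /andP[/eqP jE].
  by case/negP; apply/eqP/val_inj.
by apply: big1 => j /eqP jE; have := ltn_ord j; lia.
Qed.

(** The arithmetic progression [d, d - 1, ...] with [min(d, m)] terms; later terms of the truncated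
    ramp vanish. *)
Definition ramp_sum (d m : nat) : R :=
  (minn d m)%:R * (2 * d%:R + 1 - (minn d m)%:R) / 2.

Lemma sum_ramp (d m : nat) : \sum_(i < m) (d - i)%:R = ramp_sum d m.
Proof.
rewrite /ramp_sum; elim: m => [|m IH]; first by rewrite big_ord0 minn0; field.
rewrite big_ord_recr /= IH; case: (leqP d m) => dm.
  rewrite (_ : d - m = 0)%N ?addr0; last by lia.
  by rewrite (_ : minn d m.+1 = d)//; lia.
by rewrite (_ : minn d m.+1 = m.+1) ?natrB 1?ltnW// -?natr1; [field|lia].
Qed.

Lemma sum_ramp_sqr (d m : nat) : (d <= m)%N ->
  \sum_(i < m) (d - i)%:R ^+ 2 = d%:R * (d%:R + 1) * (2 * d%:R + 1) / 6 :> R.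
Proof.
move=> dm; transitivity (\sum_(i < d) (d - i)%:R ^+ 2 : R).
  rewrite [RHS](big_ord_widen m (fun i => (d - i)%:R ^+ 2 : R) dm).
  rewrite [RHS]big_mkcond; apply: eq_bigr => i _; case: ifPn => // id.
  by rewrite (_ : d - i = 0)%N ?expr0n//; lia.
rewrite (reindex_inj rev_ord_inj)/= {m dm}.
transitivity (\sum_(i < d) i.+1%:R ^+ 2 : R).
  by apply: eq_bigr => i _; congr (_%:R ^+ 2); have := ltn_ord i; lia.
elim: d => [|d IH]; first by rewrite big_ord0; field.
by rewrite big_ord_recr /= IH -natr1; field.
Qed.

(** A tetrahedral number: passing from [e] to [e + 1] adds a triangular number. *)
Lemma sum_ramp_cross (e : nat) :
  \sum_(i < e) (e - i)%:R * i.+1%:R =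
  e%:R * (e%:R + 1) * (e%:R + 2) / 6 :> R.
Proof.
have sum_id (m : nat) : \sum_(i < m) i.+1%:R = m%:R * (m%:R + 1) / 2 :> R.
  elim: m => [|m IH]; first by rewrite big_ord0; field.
  by rewrite big_ord_recr /= IH -natr1; field.
elim: e => [|e IH]; first by rewrite big_ord0; field.
transitivity (\sum_(i < e.+1) (e - i)%:R * i.+1%:R + \sum_(i < e.+1) i.+1%:R : R).
  rewrite -big_split; apply: eq_bigr => i _ /=.
  rewrite (_ : e.+1 - i = (e - i).+1)%N -?natr1 ?mulrDl ?mul1r//.
  by have := ltn_ord i; lia.
by rewrite sum_id big_ord_recr /= subnn mul0r addr0 IH -!natr1; field.
Qed.

(** Each coefficient is a decreasing ramp minus its mirror image. The two squares have equal sums by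
    reflection, and the cross term survives only where both ramps are positive. *)
Lemma sum_inv_coef_sqr (n d : nat) : (d <= n)%N ->
  \sum_(k < n) (@inv_coef R n d k) ^+ 2 =
  d%:R * (d%:R + 1) * (2 * d%:R + 1) / 3 -
  (d + d - n)%:R * ((d + d - n)%:R + 1) * ((d + d - n)%:R + 2) / 3.
Proof.
move=> dn; set e := (d + d - n)%N.
under eq_bigr do rewrite inv_coefE sqrrB.
rewrite big_split sumrB /= (sum_ramp_sqr dn).
have -> : \sum_(i < n) (d - (n.-1 - i))%:R ^+ 2 =
    d%:R * (d%:R + 1) * (2 * d%:R + 1) / 6 :> R.
  rewrite -(sum_ramp_sqr dn) [RHS](reindex_inj rev_ord_inj)/=.
  by apply: eq_bigr => i _; congr (_%:R ^+ 2); have := ltn_ord i; lia.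
suff -> : \sum_(i < n) (d - i)%:R * (d - (n.-1 - i))%:R *+ 2 =
    e%:R * (e%:R + 1) * (e%:R + 2) / 3 :> R by field.
rewrite sumrMnl (_ : _ / 3 = (e%:R * (e%:R + 1) * (e%:R + 2) / 6) *+ 2);
  last by field.
congr (_ *+ 2); rewrite -sum_ramp_cross.
rewrite -(big_mkord xpredT (fun i => (d - i)%:R * (d - (n.-1 - i))%:R : R)).
(* Both ramps are positive exactly for [n - d <= i < d], a window of length [e], on which they equal
   [e - i] and [i + 1] after shifting the index. *)
rewrite (big_cat_nat (n := n - d))/= ?leq_subr//.
rewrite big_nat_cond big1 ?add0r; last first.
  move=> i /andP[/andP[_ iu] _].
  by rewrite (_ : d - (n.-1 - i) = 0)%N ?mulr0//; lia.
rewrite (big_cat_nat (n := n - d + e))/=; [|lia..].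
rewrite [X in _ + X]big_nat_cond [X in _ + X]big1 ?addr0; last first.
  move=> i /andP[/andP[iu _] _].
  by rewrite (_ : d - i = 0)%N ?mul0r//; lia.
rewrite -{1}[(n - d)%N]add0n big_addn addKn big_mkord.
apply: eq_bigr => i _; have := ltn_ord i; rewrite /e => ie.
by congr (_%:R * _%:R); lia.
Qed.

(** Reversing the index pairs the four ramp sums into two equal couples, whence the factor 2. What
    remains is the sum of the ramp over its first [n - d2] places minus the sum over its last
    [n - d2] places. *)
Lemma sum_des_pair_inv_coef (n d1 d2 : nat) : (d1 <= n)%N -> (d2 <= n)%N ->
  \sum_(p : 'I_n * 'I_n | des_pair d2 p)
     (@inv_coef R n d1 p.1 - @inv_coef R n d1 p.2) =
  2 * (ramp_sum d1 (n - d2) + ramp_sum d1 d2 - d1%:R * (d1%:R + 1) / 2).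
Proof.
move=> d1n d2n; pose c (i : nat) : R := (d1 - i)%:R.
under eq_bigr do rewrite !inv_coefE.
rewrite (sum_des_pair
  (fun i j => c i - c (n.-1 - i)%N - (c j - c (n.-1 - j)%N)) d2n).
rewrite !sumrB.
have cn : \sum_(i < n) c i = d1%:R * (d1%:R + 1) / 2.
  by rewrite sum_ramp /ramp_sum (minn_idPl d1n); field.
have cs : \sum_(i < n - d2) c (i + d2)%N = d1%:R * (d1%:R + 1) / 2 - ramp_sum d1 d2.
  rewrite -cn -sum_ramp; apply/esym/eqP; rewrite subr_eq addrC.
  rewrite -(big_mkord xpredT c) (big_cat_nat (n := d2))//= big_mkord.
  rewrite [X in _ + X == _](_ : _ = \sum_(i < n - d2) c (i + d2)%N)//.
  by rewrite -{1}[d2]add0n big_addn big_mkord.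
have -> : \sum_(i < n - d2) c (n.-1 - i)%N = \sum_(i < n - d2) c (i + d2)%N.
  rewrite (reindex_inj rev_ord_inj)/=; apply: eq_bigr => i _.
  by congr c; have := ltn_ord i; lia.
have -> : \sum_(i < n - d2) c (n.-1 - (i + d2))%N = ramp_sum d1 (n - d2).
  rewrite -sum_ramp (reindex_inj rev_ord_inj)/=; apply: eq_bigr => i _.
  by congr c; have := ltn_ord i; lia.
by rewrite cs sum_ramp; field.
Qed.

(** There are [n - d] pairs and [n - 2d] (truncated) chains; each chain is counted in both orders,
    which turns 1/12 into 1/6. *)
Lemma sum_des_pair_overlap (n d : nat) : (d <= n)%N ->
  \sum_(p : 'I_n * 'I_n | des_pair d p) \sum_(q | des_pair d q)
    ((p == q)%:R / 4 - ((p.2 == q.1)%:R + (p.1 == q.2)%:R) / 12) =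
  (n - d)%:R / 4 - (n - d - d)%:R / 6 :> R.
Proof.
move=> dn.
have diag : \sum_(p : 'I_n * 'I_n | des_pair d p)
    \sum_(q | des_pair d q) (p == q)%:R = (n - d)%:R :> R.
  transitivity (\sum_(p : 'I_n * 'I_n | des_pair d p) (1 : R)).
    apply: eq_bigr => p dp; rewrite (bigD1 p)//= eqxx big1 ?addr0// => q.
    by move=> /andP[_ /negbTE qp]; rewrite eq_sym qp.
  by rewrite (sum_des_pair (fun _ _ => 1) dn) sumr_const card_ord.
have chain : \sum_(p : 'I_n * 'I_n | des_pair d p)
    \sum_(q | des_pair d q) (p.2 == q.1)%:R = (n - d - d)%:R :> R.
  transitivity (\sum_(p : 'I_n * 'I_n | des_pair d p)
      \sum_(k < n - d) (val p.2 == val k)%:R : R).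
    apply: eq_bigr => p _.
    exact: (sum_des_pair (fun i j => (val p.2 == i)%:R) dn).
  rewrite (sum_des_pair (fun i j => \sum_(k < n - d) (j == val k)%:R) dn).
  have -> : (n - d - d = \sum_(i < n - d | (0 <= i < n - d - d)%N) 1)%N.
    by rewrite sum_ord_itv; lia.
  rewrite natr_sum [RHS]big_mkcond; apply: eq_bigr => i _.
  case: ifPn => idn.
    have kn : (i + d < n - d)%N by lia.
    rewrite (bigD1 (Ordinal kn))//= eqxx big1 ?addr0// => k /eqP kE.
    by case: eqP => // ik; case: kE; apply: val_inj.
  by apply: big1 => k _; case: eqP => // ik; have := ltn_ord k;
    rewrite -[nat_of_ord k]/(val k) -ik; lia.
have chain' : \sum_(p : 'I_n * 'I_n | des_pair d p)
    \sum_(q | des_pair d q) (p.1 == q.2)%:R = (n - d - d)%:R :> R.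
  rewrite -chain exchange_big; apply: eq_bigr => p _; apply: eq_bigr => q _.
  by rewrite eq_sym.
under eq_bigr do rewrite sumrB -!mulr_suml big_split.
by rewrite sumrB -!mulr_suml big_split /= diag chain chain'; field.
Qed.

End Sums.

(** * The explicit correlation and its behaviour under rescaling *)

Section CorrelationFormula.
Context {R : realType}.

Definition cov_val (n d1 d2 : nat) : R :=
  (ramp_sum d1 (n - d2) + ramp_sum d1 d2 - d1%:R * (d1%:R + 1) / 2) / 6.

Definition var_inv_val (n d1 : nat) : R :=
  (d1%:R * (d1%:R + 1) * (2 * d1%:R + 1) -
   (d1 + d1 - n)%:R * ((d1 + d1 - n)%:R + 1) * ((d1 + d1 - n)%:R + 2)) / 36.

Definition var_des_val (n d2 : nat) : R :=
  (n - d2)%:R / 4 - (n - d2 - d2)%:R / 6.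

Definition rho_val (n d1 d2 : nat) : R :=
  cov_val n d1 d2 / Num.sqrt (var_inv_val n d1 * var_des_val n d2).

(** Probability ends here: from now on only the real sequence [rho_val] is studied. *)
Lemma correlation_Hajek (disp : measure_display) (T : measurableType disp)
    (P : probability T R) (n d1 d2 : nat) (Z : 'I_n -> {RV P >-> R}) Xhat :
  iid_uniform01 Z -> is_Hajek_projection Z (X_inv d1 Z) Xhat ->
  (d1 <= n)%N -> (0 < d2 <= n)%N ->
  correlation P Xhat (X_des d2 Z) = rho_val n d1 d2.
Proof.
move=> HZ HX d1n /andP[d20 d2n]; rewrite /correlation.
rewrite (covariance_Hajek_X_des HZ HX d20) (variance_Hajek HZ HX).
rewrite (variance_X_des HZ d20) sum_des_pair_overlap//.
rewrite sum_des_pair_inv_coef// sum_inv_coef_sqr// /rho_val; congr (_ / _).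
  by rewrite /cov_val; field.
by congr (Num.sqrt (_ * _)); rewrite /var_inv_val; field.
Qed.

Lemma natr_min (a b : nat) : (minn a b)%:R = Num.min a%:R b%:R :> R.
Proof.
case: (leqP a b) => ab; first by rewrite min_l// ler_nat.
by rewrite min_r// ler_nat ltnW.
Qed.

Lemma natr_subn_max (a b : nat) : (a - b)%:R = Num.max 0 (a%:R - b%:R) :> R.
Proof.
case: (leqP b a) => ab; first by rewrite natrB// max_r// subr_ge0 ler_nat.
rewrite (_ : a - b = 0)%N; last by lia.
by rewrite max_l// subr_le0 ler_nat ltnW.
Qed.

Lemma cvg_minr (f g : nat -> R) (a b : R) : f @ \oo --> a -> g @ \oo --> b ->
  (fun n => Num.min (f n) (g n)) @ \oo --> Num.min a b.
Proof.
move=> fa gb; rewrite minr_absE; under eq_fun do rewrite minr_absE.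
apply: cvgM; last exact: cvg_cst.
by apply: cvgB; [exact: cvgD|apply: cvg_norm; exact: cvgB].
Qed.

Lemma cvg_maxr (f g : nat -> R) (a b : R) : f @ \oo --> a -> g @ \oo --> b ->
  (fun n => Num.max (f n) (g n)) @ \oo --> Num.max a b.
Proof.
move=> fa gb; rewrite maxr_absE; under eq_fun do rewrite maxr_absE.
apply: cvgM; last exact: cvg_cst.
by apply: cvgD; [exact: cvgD|apply: cvg_norm; exact: cvgB].
Qed.

Lemma cvg_near_eq (f g : nat -> R) (l : R) :
  (\forall n \near \oo, f n = g n) -> g @ \oo --> l -> f @ \oo --> l.
Proof.
by move=> fg gl; apply: cvg_trans gl; apply: near_eq_cvg; apply: filterS fg.
Qed.

(* [u] is the inverse of the scale ([n] or [d1]) by which indices are divided. *)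
Section Scaling.
Variables (u : nat -> R) (d1 d2 : nat -> nat).
Hypotheses (u_gt0 : \forall n \near \oo, 0 < u n) (u0 : u @ \oo --> (0 : R)).

Lemma cvg_minn (d m : nat -> nat) (a b : R) :
  (forall n, 0 <= u n) ->
  (d n)%:R * u n @[n --> \oo] --> a -> (m n)%:R * u n @[n --> \oo] --> b ->
  (minn (d n) (m n))%:R * u n @[n --> \oo] --> Num.min a b.
Proof.
move=> u_ge0 da mb; under eq_fun do rewrite natr_min minr_pMl//.
exact: cvg_minr.
Qed.

Lemma cvg_subn (d m : nat -> nat) (a b : R) :
  (forall n, 0 <= u n) ->
  (d n)%:R * u n @[n --> \oo] --> a -> (m n)%:R * u n @[n --> \oo] --> b ->
  (d n - m n)%:R * u n @[n --> \oo] --> Num.max 0 (a - b).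
Proof.
move=> u_ge0 da mb; under eq_fun do rewrite natr_subn_max maxr_pMl// mul0r mulrBl.
by apply: cvg_maxr; [exact: cvg_cst|exact: cvgB].
Qed.

Lemma ramp_sum_cvg (d m : nat -> nat) (a t : R) :
  (d n)%:R * u n @[n --> \oo] --> a ->
  (minn (d n) (m n))%:R * u n @[n --> \oo] --> t ->
  ramp_sum (d n) (m n) * u n ^+ 2 @[n --> \oo] --> t * (2 * a - t) / 2.
Proof.
move=> da mt.
rewrite (_ : (fun n => _) = fun n => ((minn (d n) (m n))%:R * u n) *
  (2 * ((d n)%:R * u n) + u n - (minn (d n) (m n))%:R * u n) / 2); last first.
  by apply/funext => n; rewrite /ramp_sum; ring.
apply: cvgM; last exact: cvg_cst.
apply: cvgM => //; apply: cvgB => //.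
rewrite -[X in _ --> X]addr0; apply: cvgD => //.
by apply: cvgM => //; exact: cvg_cst.
Qed.

Lemma cov_val_cvg (a t1 t2 : R) :
  (d1 n)%:R * u n @[n --> \oo] --> a ->
  (minn (d1 n) (n - d2 n))%:R * u n @[n --> \oo] --> t1 ->
  (minn (d1 n) (d2 n))%:R * u n @[n --> \oo] --> t2 ->
  cov_val n (d1 n) (d2 n) * u n ^+ 2 @[n --> \oo] -->
    (t1 * (2 * a - t1) + t2 * (2 * a - t2) - a ^+ 2) / 12.
Proof.
move=> da h1 h2.
rewrite (_ : (fun n => _) = fun n =>
  (ramp_sum (d1 n) (n - d2 n) * u n ^+ 2 + ramp_sum (d1 n) (d2 n) * u n ^+ 2
   - ((d1 n)%:R * u n) * ((d1 n)%:R * u n + u n) / 2) / 6); last first.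
  by apply/funext => n; rewrite /cov_val; ring.
rewrite (_ : _ / 12 = (t1 * (2 * a - t1) / 2 + t2 * (2 * a - t2) / 2 -
  a * (a + 0) / 2) / 6); last by field.
apply: cvgM; last exact: cvg_cst.
apply: cvgB; first by apply: cvgD; exact: ramp_sum_cvg.
apply: cvgM; last exact: cvg_cst.
by apply: cvgM => //; exact: cvgD.
Qed.

Lemma var_inv_val_cvg (a e : R) :
  (d1 n)%:R * u n @[n --> \oo] --> a ->
  (d1 n + d1 n - n)%:R * u n @[n --> \oo] --> e ->
  var_inv_val n (d1 n) * u n ^+ 3 @[n --> \oo] -->
    (2 * a ^+ 3 - e ^+ 3) / 36.
Proof.
move=> da de.
rewrite (_ : (fun n => _) = fun n =>
  (((d1 n)%:R * u n) * ((d1 n)%:R * u n + u n) * (2 * ((d1 n)%:R * u n) + u n) -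
   ((d1 n + d1 n - n)%:R * u n) * ((d1 n + d1 n - n)%:R * u n + u n) *
   ((d1 n + d1 n - n)%:R * u n + 2 * u n)) / 36); last first.
  by apply/funext => n; rewrite /var_inv_val; ring.
rewrite (_ : _ / 36 = (a * (a + 0) * (2 * a + 0) -
   e * (e + 0) * (e + 2 * 0)) / 36); last by field.
apply: cvgM; last exact: cvg_cst.
apply: cvgB.
  by apply: cvgM; [apply: cvgM => //; apply: cvgD|
    apply: cvgD => //; apply: cvgM => //; exact: cvg_cst].
by apply: cvgM; [apply: cvgM => //; apply: cvgD|
  apply: cvgD => //; apply: cvgM => //; exact: cvg_cst].
Qed.

Lemma var_des_val_cvg (b e : R) :
  (n - d2 n)%:R * u n @[n --> \oo] --> b ->
  (n - d2 n - d2 n)%:R * u n @[n --> \oo] --> e ->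
  var_des_val n (d2 n) * u n @[n --> \oo] --> b / 4 - e / 6.
Proof.
move=> db de.
rewrite (_ : (fun n => _) = fun n =>
  ((n - d2 n)%:R * u n) / 4 - ((n - d2 n - d2 n)%:R * u n) / 6); last first.
  by apply/funext => n; rewrite /var_des_val; ring.
by apply: cvgB; (apply: cvgM; [|exact: cvg_cst]).
Qed.

(** The weights balance: the root of [u^3 * u] is [u^2], the weight of the covariance. *)
Lemma rho_val_scale n : 0 < u n ->
  rho_val n (d1 n) (d2 n) = (cov_val n (d1 n) (d2 n) * u n ^+ 2) /
    Num.sqrt ((var_inv_val n (d1 n) * u n ^+ 3) *
              (var_des_val n (d2 n) * u n)).
Proof.
move=> un; rewrite /rho_val; set X := var_inv_val _ _ * var_des_val _ _.
rewrite (_ : var_inv_val n (d1 n) * u n ^+ 3 * (var_des_val n (d2 n) * u n) =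
  (u n ^+ 2) ^+ 2 * X); last by rewrite /X; ring.
have u2 : 0 < u n ^+ 2 by rewrite exprn_gt0.
rewrite (sqrtrM X) ?exprn_ge0 ?ltW// sqrtr_sqr (gtr0_norm u2) invfM mulrA.
by rewrite mulfK ?gt_eqF.
Qed.

Lemma rho_val_cvg (A V D : R) :
  cov_val n (d1 n) (d2 n) * u n ^+ 2 @[n --> \oo] --> A ->
  var_inv_val n (d1 n) * u n ^+ 3 @[n --> \oo] --> V ->
  var_des_val n (d2 n) * u n @[n --> \oo] --> D ->
  0 < V -> 0 < D ->
  rho_val n (d1 n) (d2 n) @[n --> \oo] --> A / Num.sqrt (V * D).
Proof.
move=> hA hV hD V0 D0.
apply: (@cvg_near_eq _ (fun n => (cov_val n (d1 n) (d2 n) * u n ^+ 2) /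
    Num.sqrt ((var_inv_val n (d1 n) * u n ^+ 3) *
              (var_des_val n (d2 n) * u n)))).
  by apply: filterS u_gt0 => n; exact: rho_val_scale.
apply: cvgM => //; apply: cvgV; first by rewrite gt_eqF// sqrtr_gt0 mulr_gt0.
by apply: continuous_cvg; [exact: sqrt_continuous|exact: cvgM].
Qed.

End Scaling.
End CorrelationFormula.

(** * Bounds on the correlation and criteria for a vanishing limit *)

Section Bounds.
Context {R : realType}.

(** Put [x = d1], [m = n - d2], [s = min(x, m)] and [r = x - min(x, d2)]. Twelve times the
    covariance is [s(2x + 1 - s) - r(r + 1)], with [s] and [r] both between 0 and [min(x, m)]. The
    first bound serves small [m], the second large [m]. *)
Lemma cov_val_bounds (n d1 d2 : nat) : (d1 <= n)%N -> (d2 <= n)%N ->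
  `|cov_val n d1 d2| * 12 <= (n - d2)%:R * (2 * d1%:R + 1) :> R /\
  `|cov_val n d1 d2| * 12 <= d1%:R * (d1%:R + 1) :> R.
Proof.
move=> d1n d2n; set m := (n - d2)%N.
pose x : R := d1%:R; pose s : R := (minn d1 m)%:R; pose t : R := (minn d1 d2)%:R.
have covE : cov_val n d1 d2 * 12 =
    s * (2 * x + 1 - s) + t * (2 * x + 1 - t) - x * (x + 1) :> R.
  by rewrite /cov_val /ramp_sum -/m -/x -/s -/t; field.
rewrite -[X in _ * X](ger0_norm (ler0n R 12)) -normrM covE.
have s0 : 0 <= s by rewrite ler0n.
have t0 : 0 <= t by rewrite ler0n.
have sx : s <= x by rewrite ler_nat geq_minl.
have tx : t <= x by rewrite ler_nat geq_minl.
have sm : s <= m%:R by rewrite ler_nat geq_minr.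
have xt : x <= t + m%:R by rewrite -natrD ler_nat /m; lia.
by rewrite !ler_norml -/x; split; apply/andP; split; nra.
Qed.

Lemma var_des_val_ge (n d2 : nat) : (d2 <= n)%N ->
  (n - d2)%:R / 12 <= var_des_val n d2 :> R.
Proof.
move=> d2n; rewrite /var_des_val.
have : (n - d2 - d2)%:R <= (n - d2)%:R :> R by rewrite ler_nat leq_subr.
lra.
Qed.

(** Squaring removes the root, and the variance of the descents is replaced by its lower bound
    [(n - d2)/12]. No limit of that variance is required. *)
Lemma rho_val_sqr_le (n d1 d2 : nat) : (d2 < n)%N -> 
  0 < var_inv_val n d1 :> R ->
  rho_val n d1 d2 ^+ 2 <=
    12 * `|cov_val n d1 d2| ^+ 2 / (var_inv_val n d1 * (n - d2)%:R) :> R.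
Proof.
move=> d2n V0; have D := var_des_val_ge (ltnW d2n).
have m0 : 0 < (n - d2)%:R :> R by rewrite ltr0n subn_gt0.
have D0 : 0 < var_des_val n d2 :> R by apply: lt_le_trans D; rewrite divr_gt0.
rewrite /rho_val expr_div_n sqr_sqrtr; last by rewrite mulr_ge0// ltW.
rewrite real_normK ?num_real//.
move: (var_inv_val n d1) V0 (var_des_val n d2) D D0 => V V0 D' D D0.
rewrite ler_pdivrMr ?mulr_gt0//.
set c2 := _ ^+ 2; have c20 : 0 <= c2 by rewrite sqr_ge0.
rewrite [leRHS](_ : _ = c2 * (D' / ((n - d2)%:R / 12))); last first.
  by field; rewrite !gt_eqF.
by rewrite ler_peMr// ler_pdivlMr ?mul1r// divr_gt0.
Qed.

Lemma cvg_sqr0 (f g : nat -> R) : (\forall n \near \oo, f n ^+ 2 <= g n) ->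
  g @ \oo --> (0 : R) -> f @ \oo --> (0 : R).
Proof.
move=> fg g0; apply: norm_cvg0.
rewrite (_ : (fun n => _) = fun n => Num.sqrt (f n ^+ 2)); last first.
  by apply/funext => n; rewrite sqrtr_sqr.
rewrite -(@sqrtr0 R); apply: continuous_cvg; first exact: sqrt_continuous.
apply: (squeeze_cvgr _ (cvg_cst 0) g0).
by apply: filterS fg => n fgn; rewrite sqr_ge0.
Qed.

Section Regimes.
Variables (u : nat -> R) (d1 d2 : nat -> nat).
Hypotheses (u_gt0 : \forall n \near \oo, 0 < u n) (u0 : u @ \oo --> (0 : R)).
Hypothesis Hd1 : \forall n \near \oo, (d1 n <= n)%N.
Hypothesis Hd2 : \forall n \near \oo, (d2 n < n)%N.
Variables a V : R.
Hypotheses (da : (d1 n)%:R * u n @[n --> \oo] --> a)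
  (hV : var_inv_val n (d1 n) * u n ^+ 3 @[n --> \oo] --> V) (V0 : 0 < V).

Lemma var_inv_val_gt0 : \forall n \near \oo, 0 < var_inv_val n (d1 n) :> R.
Proof.
near=> n; have un : 0 < u n by near: n.
have : 0 < var_inv_val n (d1 n) * u n ^+ 3 by near: n; exact: (cvgr_gt V hV).
by rewrite pmulr_lgt0// exprn_gt0.
Unshelve. all: by end_near. Qed.

(** With [m = n - d2], the first covariance bound gives a squared correlation of order at most
    [m * u]. *)
Lemma rho_val_cvg0_small :
  (n - d2 n)%:R * u n @[n --> \oo] --> (0 : R) ->
  rho_val n (d1 n) (d2 n) @[n --> \oo] --> (0 : R).
Proof.
move=> mu0; pose g n : R := ((n - d2 n)%:R * u n) *
  (2 * ((d1 n)%:R * u n) + u n) ^+ 2 / (12 * (var_inv_val n (d1 n) * u n ^+ 3)).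
apply: (@cvg_sqr0 _ g).
  near=> n.
  have un : 0 < u n by near: n.
  have Vn : 0 < var_inv_val n (d1 n) :> R by near: n; exact: var_inv_val_gt0.
  have d1n : (d1 n <= n)%N by near: n.
  have d2n : (d2 n < n)%N by near: n.
  have m0 : 0 < (n - d2 n)%:R :> R by rewrite ltr0n subn_gt0.
  apply: le_trans (rho_val_sqr_le d2n Vn) _.
  have [cb _] := cov_val_bounds d1n (ltnW d2n).
  rewrite /g [leRHS](_ : _ = 12 * ((n - d2 n)%:R * (2 * (d1 n)%:R + 1) / 12) ^+ 2
    / (var_inv_val n (d1 n) * (n - d2 n)%:R)); last first.
    by move: (var_inv_val n (d1 n)) Vn => W Wn; field; rewrite !gt_eqF.
  rewrite ler_pM2r; last by rewrite invr_gt0 mulr_gt0.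
  rewrite ler_pM2l//; apply: lerXn2r; rewrite ?nnegrE//.
  by rewrite ler_pdivlMr.
rewrite -[X in _ --> X](_ : 0 * (2 * a + 0) ^+ 2 / (12 * V) = 0);
  last by rewrite !mul0r.
apply: cvgM; last first.
  apply: cvgV; first by rewrite gt_eqF// mulr_gt0.
  by apply: cvgM => //; exact: cvg_cst.
apply: cvgM => //; under eq_fun do rewrite expr2.
have h : 2 * ((d1 n)%:R * u n) + u n @[n --> \oo] --> 2 * a + 0.
  by apply: cvgD => //; apply: cvgM => //; exact: cvg_cst.
exact: cvgM.
Unshelve. all: by end_near. Qed.

(** With [m = n - d2], the second covariance bound gives a squared correlation of order at most
    [1 / (m * u)]. *)
Lemma rho_val_cvg0_large :
  ((n - d2 n)%:R * u n)^-1 @[n --> \oo] --> (0 : R) ->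
  rho_val n (d1 n) (d2 n) @[n --> \oo] --> (0 : R).
Proof.
move=> mu0; pose g n : R := ((n - d2 n)%:R * u n)^-1 *
  (((d1 n)%:R * u n) * ((d1 n)%:R * u n + u n)) ^+ 2 /
  (12 * (var_inv_val n (d1 n) * u n ^+ 3)).
apply: (@cvg_sqr0 _ g).
  near=> n.
  have un : 0 < u n by near: n.
  have Vn : 0 < var_inv_val n (d1 n) :> R by near: n; exact: var_inv_val_gt0.
  have d1n : (d1 n <= n)%N by near: n.
  have d2n : (d2 n < n)%N by near: n.
  have m0 : 0 < (n - d2 n)%:R :> R by rewrite ltr0n subn_gt0.
  apply: le_trans (rho_val_sqr_le d2n Vn) _.
  have [_ cb] := cov_val_bounds d1n (ltnW d2n).
  rewrite /g [leRHS](_ : _ = 12 * ((d1 n)%:R * ((d1 n)%:R + 1) / 12) ^+ 2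
    / (var_inv_val n (d1 n) * (n - d2 n)%:R)); last first.
    by move: (var_inv_val n (d1 n)) Vn => W Wn; field; rewrite !gt_eqF.
  rewrite ler_pM2r; last by rewrite invr_gt0 mulr_gt0.
  rewrite ler_pM2l//; apply: lerXn2r; rewrite ?nnegrE//.
  by rewrite ler_pdivlMr.
rewrite -[X in _ --> X](_ : 0 * (a * (a + 0)) ^+ 2 / (12 * V) = 0);
  last by rewrite !mul0r.
apply: cvgM; last first.
  apply: cvgV; first by rewrite gt_eqF// mulr_gt0.
  by apply: cvgM => //; exact: cvg_cst.
apply: cvgM => //; under eq_fun do rewrite expr2.
have h : ((d1 n)%:R * u n) * ((d1 n)%:R * u n + u n) @[n --> \oo] --> a * (a + 0).
  by apply: cvgM => //; exact: cvgD.
exact: cvgM.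
Unshelve. all: by end_near. Qed.

End Regimes.
End Bounds.

(** * Limits in the sublinear and linear regimes *)

Section Regimes.
Context {R : realType}.
Variables d1 d2 : nat -> nat.
Hypothesis Hd1 : forall n, (1 < n)%N -> (1 <= d1 n <= n - 1)%N.
Hypothesis Hd2 : forall n, (1 < n)%N -> (1 <= d2 n <= n - 1)%N.

Lemma near_gt1 : \forall n \near \oo, (1 < n)%N.
Proof. exact: nbhs_infty_gt. Qed.

Lemma near_d1_le : \forall n \near \oo, (d1 n <= n)%N.
Proof. by apply: filterS near_gt1 => n /Hd1; lia. Qed.

Lemma near_d2_lt : \forall n \near \oo, (d2 n < n)%N.
Proof. by apply: filterS near_gt1 => n n1; have := Hd2 n1; lia. Qed.

Lemma littleo_le (f g : nat -> R) : f =o_\oo g -> forall e, 0 < e ->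
  \forall n \near \oo, `|f n| <= e * `|g n|.
Proof. by move=> /eqoP fg e e0; exact: fg. Qed.

Lemma cvg_inv_natr : (n%:R^-1 : R) @[n --> \oo] --> (0 : R).
Proof.
apply/cvgrPdist_le => e e0; near=> n.
have n0 : (0 < n)%N by near: n; exact: nbhs_infty_gt.
rewrite sub0r normrN ger0_norm ?invr_ge0//.
rewrite invf_ple ?posrE ?ltr0n//.
by near: n; exact: nbhs_infty_ger.
Unshelve. all: by end_near. Qed.

Section Sublinear.
Hypothesis d1_o_n : (fun n => (d1 n)%:R : R) =o_\oo (fun n : nat => n%:R : R).
Hypothesis sqrt_o_d1 :
  (fun n : nat => Num.sqrt n%:R : R) =o_\oo (fun n => (d1 n)%:R : R).

Let u (n : nat) : R := (d1 n)%:R^-1.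

Let d1_gt0 : \forall n \near \oo, 0 < (d1 n)%:R :> R.
Proof. by apply: filterS near_gt1 => n /Hd1; rewrite ltr0n; lia. Qed.

Let u_gt0 : \forall n \near \oo, 0 < u n.
Proof. by apply: filterS d1_gt0 => n; rewrite /u invr_gt0. Qed.

Let u0 : u @ \oo --> (0 : R).
Proof.
apply/cvgrPdist_le => e e0; near=> n.
have dn : 0 < (d1 n)%:R :> R by near: n; exact: d1_gt0.
have n1 : (1 < n)%N by near: n; exact: near_gt1.
rewrite sub0r normrN ger0_norm ?invr_ge0//.
rewrite -[leLHS]mul1r ler_pdivrMr//.
(* Since the root of [n] is at least 1, this comparison yields [1 <= e * d1], so [d1] tends to
   infinity. *)
have : `|Num.sqrt n%:R| <= e * `|(d1 n)%:R| :> R.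
  by near: n; exact: littleo_le sqrt_o_d1 _ e0.
rewrite !ger0_norm// ?sqrtr_ge0//; apply: le_trans.
by rewrite -[leLHS]sqrtr1 ler_wsqrtr// ler1n ltnW.
Unshelve. all: by end_near. Qed.

Let da : (d1 n)%:R * u n @[n --> \oo] --> (1 : R).
Proof.
apply: (@cvg_near_eq _ _ (fun=> 1)); last exact: cvg_cst.
by apply: filterS d1_gt0 => n dn; rewrite /u divff// gt_eqF.
Qed.

Lemma d1_small (e : R) : 0 < e ->
  \forall n \near \oo, (d1 n)%:R <= e * n%:R :> R.
Proof.
move=> e0; apply: filterS (littleo_le d1_o_n e0) => n.
by rewrite !ger0_norm.
Qed.

Let hV : var_inv_val n (d1 n) * u n ^+ 3 @[n --> \oo] --> (36^-1 * 2 : R).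
Proof.
rewrite (_ : 36^-1 * 2 = (2 * 1 ^+ 3 - 0 ^+ 3) / 36); last by field.
apply: var_inv_val_cvg => //.
apply: (@cvg_near_eq _ _ (fun=> 0)); last exact: cvg_cst.
have h : 0 < 2^-1 :> R by [].
apply: filterS (d1_small h) => n dn.
have : (d1 n + d1 n <= n)%N by rewrite -(ler_nat R) natrD; lra.
by rewrite -subn_eq0 => /eqP ->; rewrite mul0r.
Qed.

Let V0 : 0 < 36^-1 * 2 :> R. Proof. by []. Qed.

Let N2 (n : nat) : R := n%:R - (d2 n)%:R.

Let N2E : \forall n \near \oo, (n - d2 n)%:R = N2 n.
Proof. by apply: filterS near_d2_lt => n dn; rewrite natrB// ltnW. Qed.

Let N2_gt0 : \forall n \near \oo, 0 < N2 n.
Proof. by apply: filterS near_d2_lt => n dn; rewrite /N2 subr_gt0 ltr_nat. Qed.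

Lemma rho_val_cvg_sublinear_small :
  N2 =o_\oo (fun n => (d1 n)%:R : R) ->
  rho_val n (d1 n) (d2 n) @[n --> \oo] --> (0 : R).
Proof.
move=> No; apply: (rho_val_cvg0_small u_gt0 u0 near_d1_le near_d2_lt da hV V0).
apply: (@cvg_near_eq _ _ (fun n => N2 n * u n)).
  by apply: filterS N2E => n ->.
apply/cvgrPdist_le => e e0; near=> n.
have dn : 0 < (d1 n)%:R :> R by near: n; exact: d1_gt0.
rewrite sub0r normrN normrM /u normfV ler_pdivrMr ?normr_gt0 ?gt_eqF//.
by near: n; exact: littleo_le No _ e0.
Unshelve. all: by end_near. Qed.

(** Domination is phrased by inequalities so that it can be fed both by a little-o hypothesis and by
    the case where [d2 / n] tends to 0. *)
Lemma rho_val_cvg_sublinear_large :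
  (forall e, 0 < e -> \forall n \near \oo, (d1 n)%:R <= e * N2 n) ->
  rho_val n (d1 n) (d2 n) @[n --> \oo] --> (0 : R).
Proof.
move=> dN; apply: (rho_val_cvg0_large u_gt0 u0 near_d1_le near_d2_lt da hV V0).
apply: (@cvg_near_eq _ _ (fun n => (N2 n * u n)^-1)).
  by apply: filterS N2E => n ->.
apply/cvgrPdist_le => e e0; near=> n.
have dn : 0 < (d1 n)%:R :> R by near: n; exact: d1_gt0.
have Nn : 0 < N2 n by near: n; exact: N2_gt0.
rewrite sub0r normrN gtr0_norm ?invr_gt0 ?mulr_gt0 ?invr_gt0//.
rewrite invfM invrK mulrC ler_pdivrMr//.
by near: n; exact: dN.
Unshelve. all: by end_near. Qed.

(** In the scale [d1], the two minima in the covariance tend to [min(1, c)] and 1, and the variances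
    tend to 1/18 and [c/4]. The value of [min(1, c)] is what separates (b) from (c). *)
Lemma rho_val_cvg_sublinear_mid (c : R) : 0 < c ->
  (exists2 e : nat -> R, e =o_\oo (fun=> 1 : R) &
     \forall n \near \oo, N2 n = c * (d1 n)%:R * (1 + e n)) ->
  let t := Num.min 1 c in
  rho_val n (d1 n) (d2 n) @[n --> \oo] -->
    t * (2 - t) / 12 / Num.sqrt (c / 72).
Proof.
move=> c0 [e e1 Ne] t.
have e0 : e @ \oo --> (0 : R).
  apply/cvgrPdist_le => r r0; apply: filterS (littleo_le e1 r0) => n.
  by rewrite normr1 mulr1 sub0r normrN.
have mu : (n - d2 n)%:R * u n @[n --> \oo] --> c.
  apply: (@cvg_near_eq _ _ (fun n => c * (1 + e n))).
    near=> n.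
    have dn : 0 < (d1 n)%:R :> R by near: n; exact: d1_gt0.
    have -> : (n - d2 n)%:R = N2 n by near: n; exact: N2E.
    have -> : N2 n = c * (d1 n)%:R * (1 + e n) by near: n.
    by rewrite /u; field; rewrite gt_eqF.
  rewrite -[X in _ --> X](_ : c * (1 + 0) = c); last by rewrite addr0 mulr1.
  by apply: cvgM; [exact: cvg_cst|apply: cvgD => //; exact: cvg_cst].
have u_ge0 n : 0 <= u n by rewrite /u invr_ge0.
(* Since [d1 = o(n)] and [n - d2 = O(d1)], eventually [d2] dominates both. *)
have dd : \forall n \near \oo, (d1 n <= d2 n)%N /\ (n - d2 n <= d2 n)%N.
  (* Eventually [n - d2 < (c + 1) d1] and [n >= (2c + 3) d1], so [d2 > (c + 2) d1], which exceeds
     both [d1] and [n - d2]. *)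
  have k0 : 0 < (2 * (c + 1) + 1)^-1 by rewrite invr_gt0; lra.
  near=> n.
  have dn : 0 < (d1 n)%:R :> R by near: n; exact: d1_gt0.
  have d2n : (d2 n < n)%N by near: n; exact: near_d2_lt.
  have mc : (n - d2 n)%:R * u n < c + 1.
    by near: n; apply: (cvgr_lt c) => //; rewrite ltrDl.
  have : (d1 n)%:R <= (2 * (c + 1) + 1)^-1 * n%:R :> R.
    by near: n; exact: (d1_small k0).
  rewrite mulrC ler_pdivlMr; last by lra.
  move: mc; rewrite /u ltr_pdivrMr// (natrB _ (ltnW d2n)) => mc nd.
  have p0 : 0 < c * (d1 n)%:R by rewrite mulr_gt0.
  have {}mc : n%:R - (d2 n)%:R < c * (d1 n)%:R + (d1 n)%:R by lra.
  have {}nd : 2 * (c * (d1 n)%:R) + 3 * (d1 n)%:R <= n%:R by lra.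
  by rewrite -!(ler_nat R) (natrB _ (ltnW d2n)); split; lra.
rewrite (_ : c / 72 = (36^-1 * 2) * (c / 4 - 0 / 6)); last by field.
rewrite (_ : t * (2 - t) / 12 =
  (t * (2 * 1 - t) + 1 * (2 * 1 - 1) - 1 ^+ 2) / 12); last by field.
apply: (rho_val_cvg u_gt0) => //.
- apply: cov_val_cvg => //; first exact: cvg_minn.
  apply: (@cvg_near_eq _ _ (fun n => (d1 n)%:R * u n)) => //.
  by apply: filterS dd => n [/minn_idPl ->].
- apply: var_des_val_cvg => //.
  apply: (@cvg_near_eq _ _ (fun=> 0)); last exact: cvg_cst.
  by apply: filterS dd => n [_]; rewrite -subn_eq0 => /eqP ->; rewrite mul0r.
- by rewrite mul0r subr0 divr_gt0.
Unshelve. all: by end_near. Qed.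

End Sublinear.

Section Linear.
Variables c1 c2 : R.
Hypotheses (h1 : (d1 n)%:R / n%:R @[n --> \oo] --> c1)
  (h2 : (d2 n)%:R / n%:R @[n --> \oo] --> c2).
Hypotheses (c1b : 0 < c1 <= 1) (c2b : 0 <= c2 <= 1).

Let u (n : nat) : R := n%:R^-1.

Let u_ge0 n : 0 <= u n. Proof. by rewrite /u invr_ge0. Qed.

Let u_gt0 : \forall n \near \oo, 0 < u n.
Proof. by apply: filterS near_gt1 => n n1; rewrite /u invr_gt0 ltr0n; lia. Qed.

Let u0 : u @ \oo --> (0 : R). Proof. exact: cvg_inv_natr. Qed.

Let n1 : n%:R * u n @[n --> \oo] --> (1 : R).
Proof.
apply: (@cvg_near_eq _ _ (fun=> 1)); last exact: cvg_cst.
by apply: filterS near_gt1 => n n1; rewrite /u divff// pnatr_eq0; lia.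
Qed.

Let mu : (n - d2 n)%:R * u n @[n --> \oo] --> 1 - c2.
Proof.
have := cvg_subn u_ge0 n1 h2; rewrite max_r//.
by have /andP[_] := c2b; rewrite subr_ge0.
Qed.

Definition linear_var : R := (2 * c1 ^+ 3 - Num.max 0 (2 * c1 - 1) ^+ 3) / 36.

Let hV : var_inv_val n (d1 n) * u n ^+ 3 @[n --> \oo] --> linear_var.
Proof.
apply: var_inv_val_cvg => //; apply: (cvg_subn (d := fun n => d1 n + d1 n)%N) => //.
under eq_fun do rewrite natrD mulrDl.
by rewrite mulrDl mul1r; exact: cvgD.
Qed.

Lemma linear_var_gt0 : 0 < linear_var.
Proof.
have /andP[c10 c11] := c1b; rewrite divr_gt0// subr_gt0.
case: (leP 0 (2 * c1 - 1)) => h; last by rewrite expr0n /= mulr_gt0// exprn_gt0.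
(* As [c1 <= 1] gives [2 c1 - 1 <= c1], the numerator is at least [c1^3]. *)
have : (2 * c1 - 1) ^+ 3 <= c1 ^+ 3 by apply: lerXn2r; rewrite ?nnegrE; lra.
have : 0 < c1 ^+ 3 by rewrite exprn_gt0.
lra.
Qed.

(** The bound [c2 < 1] keeps the limiting variance of the descents positive; at [c2 = 1] it
    degenerates and the small-[m] estimate takes over. *)
Lemma rho_val_cvg_linear : c2 < 1 ->
  let s := Num.min c1 (1 - c2) in let t := Num.min c1 c2 in
  rho_val n (d1 n) (d2 n) @[n --> \oo] -->
    (s * (2 * c1 - s) + t * (2 * c1 - t) - c1 ^+ 2) / 12 /
    Num.sqrt (linear_var * ((1 - c2) / 4 - Num.max 0 (1 - c2 - c2) / 6)).
Proof.
move=> c21 s t; apply: (rho_val_cvg u_gt0) => //.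
- by apply: cov_val_cvg => //; exact: cvg_minn.
- by apply: var_des_val_cvg => //; exact: (cvg_subn (d := fun n => n - d2 n)%N).
- exact: linear_var_gt0.
- by have /andP[c20 _] := c2b; case: (leP 0 (1 - c2 - c2)) => h; lra.
Qed.

Lemma rho_val_cvg_linear1 : c2 = 1 ->
  rho_val n (d1 n) (d2 n) @[n --> \oo] --> (0 : R).
Proof.
move=> c21; apply: (rho_val_cvg0_small u_gt0 u0 near_d1_le near_d2_lt h1 hV).
  exact: linear_var_gt0.
by have := mu; rewrite c21 subrr.
Qed.

End Linear.
End Regimes.

(** * Matching the limits with the closed forms of each case *)

Section CaseAlgebra.
Context {R : realType}.
Implicit Types c : R.

(** Nonnegative numbers are compared through their squares, so each case reduces to sign conditions
    and a rational identity. *)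
Lemma div_sqrt_eq (A x L : R) : 0 <= A -> 0 < x -> 0 <= L ->
  A ^+ 2 = L ^+ 2 * x -> A / Num.sqrt x = L.
Proof.
move=> A0 x0 L0 AL; have sx : 0 < Num.sqrt x by rewrite sqrtr_gt0.
apply/eqP; rewrite -(@eqrXn2 _ 2)// ?divr_ge0// ?ltW//.
by rewrite expr_div_n sqr_sqrtr ?ltW// AL mulfK// gt_eqF.
Qed.

Lemma powR_3_2_sqr c : 0 <= c -> (c `^ (3 / 2)) ^+ 2 = c ^+ 3.
Proof.
move=> c0; rewrite -powR_mulrn ?powR_ge0// -powRrM.
by rewrite (_ : 3 / 2 * 2 = 3)// ?powR_mulrn//; field.
Qed.

Lemma linear_var_small c : c <= 1 / 2 -> linear_var c = c ^+ 3 / 18.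
Proof. by move=> h; rewrite /linear_var max_l; [field|lra]. Qed.

Lemma linear_var_large c : 1 / 2 < c -> linear_var c = p_corr c / 3.
Proof. by move=> h; rewrite /linear_var /p_corr max_r; [field|lra]. Qed.

(** The limiting variance of the descents is [(1 + c2)/12] for [c2 <= 1/2] and [(1 - c2)/4] beyond,
    which is where the two kinds of roots in the case formulas come from. *)
Definition linear_limit c1 c2 : R :=
  let s := Num.min c1 (1 - c2) in let t := Num.min c1 c2 in
  (s * (2 * c1 - s) + t * (2 * c1 - t) - c1 ^+ 2) / 12 /
  Num.sqrt (linear_var c1 * ((1 - c2) / 4 - Num.max 0 (1 - c2 - c2) / 6)).

Lemma p_corr_gt0 c : 1 / 2 < c -> c <= 1 -> 0 < p_corr c.
Proof.
move=> h c1; have c0 : 0 < c by lra.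
have := @linear_var_gt0 _ c; rewrite c0 c1 linear_var_large//.
by move=> /(_ isT); lra.
Qed.

Lemma linear_limit_d c1 c2 : 0 < c1 <= 1 -> 0 <= c2 < 1 ->
  c1 <= c2 <= 1 / 2 ->
  linear_limit c1 c2 = Num.sqrt 6 / 2 * Num.sqrt (c1 / (1 + c2)).
Proof.
move=> /andP[c10 c11] /andP[c20 c21] /andP[h1 h2].
have c13 : 0 < c1 ^+ 3 by rewrite exprn_gt0.
rewrite /linear_limit linear_var_small; last by lra.
rewrite !min_l ?max_r; [|lra..].
apply: div_sqrt_eq; rewrite ?mulr_ge0 ?sqrtr_ge0//.
- by rewrite (_ : _ - _ = c1 ^+ 2) ?exprn_ge0 ?ltW//; ring.
- by rewrite mulr_gt0 ?divr_gt0//; lra.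
- rewrite !exprMn !sqr_sqrtr ?divr_ge0//; [|lra..].
  by field; lra.
Qed.

Lemma linear_limit_e1 c1 c2 : 0 < c1 <= 1 -> 0 <= c2 < 1 ->
  c1 <= 1 / 2 -> 1 / 2 < c2 -> c2 <= 1 - c1 ->
  linear_limit c1 c2 = Num.sqrt c1 / Num.sqrt (2 * (1 - c2)).
Proof.
move=> /andP[c10 c11] /andP[c20 c21] h1 h2 h3.
have c13 : 0 < c1 ^+ 3 by rewrite exprn_gt0.
rewrite /linear_limit linear_var_small//.
rewrite !min_l ?max_l; [|lra..].
apply: div_sqrt_eq; rewrite ?divr_ge0 ?sqrtr_ge0//.
- by rewrite (_ : _ - _ = c1 ^+ 2) ?exprn_ge0 ?ltW//; ring.
- by rewrite mulr_gt0 ?divr_gt0//; lra.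
- rewrite !expr_div_n !sqr_sqrtr ?divr_ge0//; [|lra..].
  by field; lra.
Qed.

Lemma linear_limit_e2 c1 c2 : 0 < c1 <= 1 -> 0 <= c2 < 1 ->
  c1 <= 1 / 2 -> 1 / 2 < c2 -> 1 - c1 < c2 ->
  linear_limit c1 c2 = f_corr c1 c2 / (Num.sqrt 2 * c1 `^ (3 / 2)).
Proof.
move=> /andP[c10 c11] /andP[c20 c21] h1 h2 h3.
have c13 : 0 < c1 ^+ 3 by rewrite exprn_gt0.
rewrite /linear_limit linear_var_small// /f_corr.
rewrite min_r ?min_l ?max_l; [|lra..].
apply: div_sqrt_eq; rewrite ?divr_ge0 ?mulr_ge0 ?sqrtr_ge0 ?powR_ge0//; try lra.
- rewrite (_ : _ - c1 ^+ 2 = (1 - c2) * (2 * c1 + c2 - 1)); last by ring.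
  by rewrite mulr_ge0//; lra.
- by rewrite mulr_gt0 ?divr_gt0//; lra.
- rewrite !(expr_div_n, exprMn) (powR_3_2_sqr (ltW c10)) !sqr_sqrtr; [|lra..].
  by field; rewrite gt_eqF.
Qed.

Lemma linear_limit_f c1 c2 : 0 < c1 <= 1 -> 0 <= c2 < 1 ->
  1 / 2 < c1 <= c2 ->
  linear_limit c1 c2 =
  Num.sqrt 3 / 6 * (f_corr c1 c2 / Num.sqrt (p_corr c1)).
Proof.
move=> /andP[c10 c11] /andP[c20 c21] /andP[h1 h2].
rewrite /linear_limit linear_var_large// /f_corr.
(* Only the positivity of [p_corr c1] matters from here, so it is abstracted to an atom for the
   field identity. *)
have pp := p_corr_gt0 h1 c11; move: (p_corr c1) pp => p pp.
rewrite min_r ?min_l ?max_l; [|lra..].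
have N0 : 0 <= (1 - c2) * (2 * c1 + c2 - 1) by rewrite mulr_ge0//; lra.
have f0 : 0 <= Num.sqrt (1 - c2) * (2 * c1 + c2 - 1).
  by rewrite mulr_ge0 ?sqrtr_ge0//; lra.
apply: div_sqrt_eq.
- rewrite (_ : _ - c1 ^+ 2 = (1 - c2) * (2 * c1 + c2 - 1)) ?divr_ge0//.
  by ring.
- by rewrite mulr_gt0 ?divr_gt0//; lra.
- by apply: mulr_ge0; apply: divr_ge0; rewrite ?sqrtr_ge0.
- rewrite !(exprMn, expr_div_n, exprVn) !sqr_sqrtr; [|lra..].
  by field; rewrite gt_eqF.
Qed.

Lemma linear_limit_g c1 c2 : 0 < c1 <= 1 -> 0 <= c2 < 1 ->
  c1 <= 1 / 2 -> c2 < c1 ->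
  linear_limit c1 c2 = Num.sqrt 6 * g_corr c1 c2 / (2 * c1 `^ (3 / 2)).
Proof.
move=> /andP[c10 c11] /andP[c20 c21] h1 h2.
have c13 : 0 < c1 ^+ 3 by rewrite exprn_gt0.
rewrite /linear_limit linear_var_small// /g_corr.
rewrite min_l ?min_r ?max_r; [|lra..].
have N0 : 0 <= 2 * c1 * c2 - c2 ^+ 2.
  by rewrite (_ : _ - _ = c2 * (2 * c1 - c2)) ?mulr_ge0//; [lra|ring].
apply: div_sqrt_eq.
- by rewrite (_ : _ - c1 ^+ 2 = 2 * c1 * c2 - c2 ^+ 2) ?divr_ge0//; ring.
- by rewrite mulr_gt0 ?divr_gt0//; lra.
- by rewrite divr_ge0 ?mulr_ge0 ?divr_ge0 ?sqrtr_ge0 ?powR_ge0.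
- rewrite !(expr_div_n, exprMn) (powR_3_2_sqr (ltW c10)) !sqr_sqrtr; [|lra..].
  by field; rewrite !gt_eqF//; lra.
Qed.

Lemma linear_limit_h c1 c2 : 0 < c1 <= 1 -> 0 <= c2 < 1 ->
  1 / 2 < c1 -> c2 <= 1 - c1 ->
  linear_limit c1 c2 = g_corr c1 c2 / (2 * Num.sqrt (p_corr c1)).
Proof.
move=> /andP[c10 c11] /andP[c20 c21] h1 h2.
rewrite /linear_limit linear_var_large// /g_corr.
have pp := p_corr_gt0 h1 c11; move: (p_corr c1) pp => p pp.
rewrite min_l ?min_r ?max_r; [|lra..].
have N0 : 0 <= 2 * c1 * c2 - c2 ^+ 2.
  by rewrite (_ : _ - _ = c2 * (2 * c1 - c2)) ?mulr_ge0//; [lra|ring].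
apply: div_sqrt_eq.
- by rewrite (_ : _ - c1 ^+ 2 = 2 * c1 * c2 - c2 ^+ 2) ?divr_ge0//; ring.
- by rewrite mulr_gt0 ?divr_gt0//; lra.
- by rewrite divr_ge0 ?mulr_ge0 ?divr_ge0 ?sqrtr_ge0.
- rewrite !(expr_div_n, exprMn) !sqr_sqrtr; [|lra..].
  by field; rewrite !gt_eqF//; lra.
Qed.

(** Both [c2] and [1 - c2] are at least [1 - c1], so their product dominates its square. This sign
    is needed to compare squares in (i). *)
Lemma h_num_ge0 c1 c2 : c1 <= 1 -> 1 - c1 < c2 < c1 ->
  0 <= 2 * c2 * (1 - c2) - (1 - c1) ^+ 2.
Proof.
move=> c11 /andP[h1 h2]; have x0 : 0 <= 1 - c1 by lra.
have : (1 - c1) * (1 - c1) <= c2 * (1 - c2) by apply: ler_pM; lra.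
have : 0 <= c2 * (1 - c2) by rewrite mulr_ge0//; lra.
by rewrite expr2; lra.
Qed.

Lemma linear_limit_i1 c1 c2 : 0 < c1 <= 1 -> 0 <= c2 < 1 ->
  1 - c1 < c2 < c1 -> c2 <= 1 / 2 ->
  linear_limit c1 c2 = h_corr c1 c2 / (2 * Num.sqrt (1 + c2)).
Proof.
move=> /andP[c10 c11] /andP[c20 c21] hh h3.
have N0 := h_num_ge0 c11 hh; move: hh => /andP[h1 h2].
rewrite /linear_limit linear_var_large /h_corr; last by lra.
have pp : 0 < p_corr c1 by apply: p_corr_gt0; lra.
move: (p_corr c1) pp => p pp.
rewrite !min_r ?max_r; [|lra..].
apply: div_sqrt_eq.
- rewrite (_ : _ - c1 ^+ 2 = 2 * c2 * (1 - c2) - (1 - c1) ^+ 2) ?divr_ge0//.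
  by ring.
- by rewrite mulr_gt0 ?divr_gt0//; lra.
- by rewrite divr_ge0 ?mulr_ge0 ?divr_ge0 ?sqrtr_ge0.
- rewrite !(expr_div_n, exprMn) !sqr_sqrtr; [|lra..].
  by field; rewrite !gt_eqF//; lra.
Qed.

Lemma linear_limit_i2 c1 c2 : 0 < c1 <= 1 -> 0 <= c2 < 1 ->
  1 - c1 < c2 < c1 -> 1 / 2 < c2 ->
  linear_limit c1 c2 =
  Num.sqrt 3 / 6 * (h_corr c1 c2 / Num.sqrt (1 - c2)).
Proof.
move=> /andP[c10 c11] /andP[c20 c21] hh h3.
have N0 := h_num_ge0 c11 hh; move: hh => /andP[h1 h2].
rewrite /linear_limit linear_var_large /h_corr; last by lra.
have pp : 0 < p_corr c1 by apply: p_corr_gt0; lra.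
move: (p_corr c1) pp => p pp.
rewrite !min_r ?max_l; [|lra..].
apply: div_sqrt_eq.
- rewrite (_ : _ - c1 ^+ 2 = 2 * c2 * (1 - c2) - (1 - c1) ^+ 2) ?divr_ge0//.
  by ring.
- by rewrite mulr_gt0 ?divr_gt0//; lra.
- by rewrite mulr_ge0 ?divr_ge0 ?mulr_ge0 ?sqrtr_ge0.
- rewrite !(exprMn, expr_div_n, exprVn) !sqr_sqrtr; [|lra..].
  by field; rewrite !gt_eqF//; lra.
Qed.

Lemma linear_limit_c20 c1 c2 : 0 < c1 <= 1 -> 0 <= c2 < 1 ->
  c2 = 0 -> linear_limit c1 c2 = 0.
Proof.
move=> /andP[c10 c11] /andP[c20 c21] c2E.
rewrite /linear_limit c2E.
rewrite [Num.min c1 0]min_r ?ltW// min_l; last by lra.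
by rewrite (_ : _ - c1 ^+ 2 = 0) ?mul0r//; ring.
Qed.

Lemma sublinear_limit_b c : 1 <= c -> let t := Num.min 1 c in
  t * (2 - t) / 12 / Num.sqrt (c / 72) = 1 / Num.sqrt (2 * c).
Proof.
move=> h /=; rewrite min_l//; apply: div_sqrt_eq.
- lra.
- lra.
- by rewrite divr_ge0 ?sqrtr_ge0.
- rewrite !expr_div_n sqr_sqrtr; last by lra.
  by field; lra.
Qed.

Lemma sublinear_limit_c c : 0 < c < 1 -> let t := Num.min 1 c in
  t * (2 - t) / 12 / Num.sqrt (c / 72) = Num.sqrt (2 * c) * (1 - c / 2).
Proof.
move=> /andP[h1 h2] /=; rewrite min_r ?ltW//; apply: div_sqrt_eq.
- by rewrite divr_ge0// mulr_ge0//; lra.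
- lra.
- by rewrite mulr_ge0 ?sqrtr_ge0//; lra.
- rewrite !exprMn sqr_sqrtr; last by lra.
  by field.
Qed.

End CaseAlgebra.

(** * The limit of the correlation in every regime *)

Unset Implicit Arguments.
Set Strict Implicit.

Theorem theorem3p9 (R : realType) (disp : nat -> measure_display)
    (T : forall n, measurableType (disp n))
    (P : forall n, probability (T n) R)
    (Z : forall n, 'I_n -> {RV (P n) >-> R})
    (HZ : forall n, iid_uniform01 (Z n))
    (d1 d2 : nat -> nat)
    (Hd1 : forall n, (1 < n)%N -> (1 <= d1 n <= n - 1)%N)
    (Hd2 : forall n, (1 < n)%N -> (1 <= d2 n <= n - 1)%N)
    (Xhat : forall n, T n -> R)
    (HXhat : forall n, is_Hajek_projection (Z n) (X_inv (d1 n) (Z n)) (Xhat n)) :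
  let rho (n : nat) : R :=
    correlation (P n) (Xhat n) (X_des (d2 n) (Z n)) in
  let D1 (n : nat) : R := (d1 n)%:R in
  let N2 (n : nat) : R := n%:R - (d2 n)%:R in
  let sublinear : Prop :=
    D1 =o_\oo (fun n : nat => n%:R : R) /\
    (fun n : nat => Num.sqrt n%:R : R) =o_\oo D1 in
  let linear (c1 c2 : R) : Prop :=
    [/\ (d1 n)%:R / n%:R @[n --> \oo] --> c1,
        (d2 n)%:R / n%:R @[n --> \oo] --> c2,
        0 < c1 <= 1 & 0 <= c2 <= 1] in
  (sublinear ->
    [/\ (* (a) *)
        N2 =o_\oo D1 \/ D1 =o_\oo N2 -> rho @ \oo --> (0 : R),
        (* (b) *)
        forall c : R, 1 <= c ->
          (exists2 e : nat -> R, e =o_\oo (fun=> 1 : R) &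
             \forall n \near \oo, N2 n = c * D1 n * (1 + e n)) ->
          rho @ \oo --> 1 / Num.sqrt (2 * c) &
        (* (c) *)
        forall c : R, 0 < c < 1 ->
          (exists2 e : nat -> R, e =o_\oo (fun=> 1 : R) &
             \forall n \near \oo, N2 n = c * D1 n * (1 + e n)) ->
          rho @ \oo --> Num.sqrt (2 * c) * (1 - c / 2)]) /\
  (forall c1 c2 : R, linear c1 c2 ->
    (* (d) *)
    (c1 <= c2 <= 1 / 2 ->
      rho @ \oo --> Num.sqrt 6 / 2 * Num.sqrt (c1 / (1 + c2))) /\
    (* (e) *)
    (c1 <= 1 / 2 -> 1 / 2 < c2 ->
      (c2 <= 1 - c1 ->
        rho @ \oo --> Num.sqrt c1 / Num.sqrt (2 * (1 - c2))) /\
      (c2 > 1 - c1 ->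
        rho @ \oo --> f_corr c1 c2 / (Num.sqrt 2 * c1 `^ (3 / 2)))) /\
    (* (f) *)
    (1 / 2 < c1 <= c2 ->
      rho @ \oo --> Num.sqrt 3 / 6 * (f_corr c1 c2 / Num.sqrt (p_corr c1))) /\
    (* (g) *)
    (c1 <= 1 / 2 -> 0 < c2 < c1 ->
      rho @ \oo --> Num.sqrt 6 * g_corr c1 c2 / (2 * c1 `^ (3 / 2))) /\
    (* (h) *)
    (1 / 2 < c1 -> c2 <= 1 - c1 ->
      rho @ \oo --> g_corr c1 c2 / (2 * Num.sqrt (p_corr c1))) /\
    (* (i) *)
    (1 - c1 < c2 < c1 ->
      (c2 <= 1 / 2 ->
        rho @ \oo --> h_corr c1 c2 / (2 * Num.sqrt (1 + c2))) /\
      (1 / 2 < c2 ->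
        rho @ \oo --> Num.sqrt 3 / 6 * (h_corr c1 c2 / Num.sqrt (1 - c2)))) /\
    (* c2 = 1 *)
    (c2 = 1 -> rho @ \oo --> (0 : R))) /\
  (* c2 = 0, in either regime *)
  ((sublinear /\ (d2 n)%:R / n%:R @[n --> \oo] --> (0 : R)) \/
   (exists c1 : R, linear c1 0) ->
   rho @ \oo --> (0 : R)).
Proof.
move=> rho D1 N2 sublinear linear.
have rhoE (l : R) : rho_val n (d1 n) (d2 n) @[n --> \oo] --> l ->
    rho @ \oo --> l.
  apply: cvg_near_eq; apply: filterS near_gt1 => n n1.
  have /andP[d11 d1n] := Hd1 n n1; have /andP[d21 d2n] := Hd2 n n1.
  have nn : (n - 1 <= n)%N by exact: leq_subr.
  rewrite /rho; apply: (correlation_Hajek (HZ n) (HXhat n)).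
    exact: leq_trans d1n nn.
  by rewrite d21 (leq_trans d2n nn).
have N2_gt0 : \forall n \near \oo, 0 < N2 n.
  by apply: filterS (near_d2_lt Hd2) => n dn; rewrite /N2 subr_gt0 ltr_nat.
split; [|split].
- move=> [s1 s2]; split.
  + move=> [h|h]; apply: rhoE.
      exact: (rho_val_cvg_sublinear_small Hd1 Hd2 s1 s2 h).
    apply: (rho_val_cvg_sublinear_large Hd1 Hd2 s1 s2) => e e0.
    apply: filterS2 (littleo_le h e0) N2_gt0 => n.
    by rewrite /D1 => + Nn; rewrite ger0_norm// gtr0_norm.
  + move=> c c1 h; apply: rhoE; rewrite -sublinear_limit_b//.
    by apply: (rho_val_cvg_sublinear_mid Hd1 Hd2 s1 s2) => //; lra.
  + move=> c c01 h; apply: rhoE; rewrite -sublinear_limit_c//.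
    by apply: (rho_val_cvg_sublinear_mid Hd1 Hd2 s1 s2) => //; lra.
- move=> c1 c2 [h1 h2 c1b c2b].
  have lin (l : R) : c2 < 1 -> (0 <= c2 < 1 -> linear_limit c1 c2 = l) ->
      rho @ \oo --> l.
    move=> c21 lE; apply: rhoE.
    have /lE <- : 0 <= c2 < 1 by have /andP[-> _] := c2b.
    exact: (rho_val_cvg_linear h1 h2 c1b c2b c21).
  have lin1 : c2 = 1 -> rho @ \oo --> (0 : R).
    by move=> c21; apply: rhoE; exact: (rho_val_cvg_linear1 Hd1 Hd2 h1 h2 c1b).
  have /andP[c10 c11] := c1b; have /andP[c20 c21] := c2b.
  (* The second half of (e) and case (f) allow [c2 = 1]. There [f_corr] vanishes through its factor
     [sqrt(1 - c2)], in agreement with the separately proved limit 0. *)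
  have c2E : c2 < 1 \/ c2 = 1.
    by move: c21; rewrite le_eqVlt => /orP[/eqP|]; [right|left].
  split=> [h|].
    by apply: lin; [lra|move=> ?; exact: linear_limit_d].
  split=> [ha hb|].
    split=> hc; first by apply: lin; [lra|move=> ?; exact: linear_limit_e1].
    case: c2E => c2E; first by apply: lin => // ?; exact: linear_limit_e2.
    rewrite /f_corr c2E subrr sqrtr0 !mul0r; exact: lin1.
  split=> [h|].
    case: c2E => c2E; first by apply: lin => // ?; exact: linear_limit_f.
    rewrite /f_corr c2E subrr sqrtr0 !mul0r mulr0; exact: lin1.
  split=> [ha /andP[hb hc]|].
    by apply: lin; [lra|move=> ?; exact: linear_limit_g].
  split=> [ha hb|].
    by apply: lin; [lra|move=> ?; exact: linear_limit_h].
  split=> // h; split=> h'.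
    by apply: lin; [lra|move=> ?; exact: linear_limit_i1].
  by apply: lin; [lra|move=> ?; exact: linear_limit_i2].
- move=> [[[s1 s2] h2]|[c1 [h1 h2 c1b c2b]]]; apply: rhoE.
    apply: (rho_val_cvg_sublinear_large Hd1 Hd2 s1 s2) => e e0.
    (* Eventually [d2 < n/2], so [n - d2 > n/2], and [d1 <= (e/2) n] gives [d1 <= e (n - d2)]. *)
    have e20 : 0 < e / 2 by rewrite divr_gt0.
    near=> n.
    have n0 : 0 < n%:R :> R.
      by rewrite ltr0n; near: n; exact: nbhs_infty_gt.
    have d1n : (d1 n)%:R <= e / 2 * n%:R :> R.
      by near: n; exact: (d1_small s1 e20).
    have : (d2 n)%:R / n%:R < 1 / 2 :> R by near: n; apply: (cvgr_lt _ h2).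
    rewrite ltr_pdivrMr// => d2n; apply: le_trans d1n _.
    by rewrite -mulrA ler_pM2l//; lra.
  rewrite -(@linear_limit_c20 _ c1 0) ?lexx ?ltr01//.
  exact: (rho_val_cvg_linear h1 h2 c1b c2b ltr01).
Unshelve. all: by end_near. Qed.
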